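(* Let $D$ be a strongly connected balanced bipartite digraph with partite sets of cardinality $a$, where $a\geq 3$. Suppose that $d(u)+d(v)\geq 3a$ for every pair of distinct vertices $u,v\in V(D)$ which have a common in-neighbour or a common out-neighbour. Then $D$ is either bipancyclic (i.e., $D$ contains a directed cycle of every even length $2,4,\dots,2a$) or $D$ is a directed cycle of length $2a$.
   Context: A digraph $D$ is a pair $(V(D),A(D))$ with $V(D)$ a finite set of vertices and $A(D)$ a set of ordered pairs of distinct vertices (arcs); there are no loops or multiple arcs, but both $uv$ and $vu$ may be arcs. If $uv\in A(D)$, then $u$ is an in-neighbour of $v$ and $v$ is an out-neighbour of $u$. The degree of a vertex is $d(v)=d^+(v)+d^-(v)$, where $d^+(v)$ and $d^-(v)$ are the numbers of out-neighbours and in-neighbours of $v$. $D$ is bipartite if $V(D)$ is a disjoint union of two independent sets (the partite sets), and balanced if these have equal cardinality. All cycles are directed; a cycle of length 2 consists of vertices $u,v$ with both $uv,vu\in A(D)$. ''$D$ is a directed cycle of length $2a$'' means that $D$ has $2a$ vertices and its arc set consists exactly of the arcs of one directed cycle through all of them. *)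

(* Defs.v *)
From mathcomp Require Import all_boot.

Set Implicit Arguments.
Unset Strict Implicit.
Unset Printing Implicit Defensive.

(* A digraph on the vertex set V is an arc relation e : rel V, where [e u v]
   means that uv is an arc; absence of loops is [irreflexive e]. *)
Section Digraph.

Variables (V : finType) (e : rel V).
Implicit Types (u v w : V) (X Y : {set V}) (c : seq V).

Definition outdeg v : nat := #|[set w | e v w]|.
Definition indeg v : nat := #|[set w | e w v]|.
Definition deg v : nat := outdeg v + indeg v.

Definition strongly_connected : Prop := forall u v, connect e u v.

Definition independent X : Prop := {in X &, forall u v, ~~ e u v}.

Definition bipartition X Y : Prop :=
  [/\ X :|: Y = [set: V], [disjoint X & Y], independent X & independent Y].

Definition common_in_neighbour u v : Prop := exists w, e w u /\ e w v.
Definition common_out_neighbour u v : Prop := exists w, e u w /\ e v w.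

(* Without the bound on the size, [::] would count as a cycle. *)
Definition dicycle c : Prop := [/\ 2 <= size c, uniq c & cycle e c].

Definition bipancyclic : Prop :=
  forall k, 2 <= k <= #|V| -> ~~ odd k -> exists2 c, dicycle c & size c = k.

(* [next c u] is the successor of u on c, read cyclically. *)
Definition is_directed_cycle (n : nat) : Prop :=
  exists c, [/\ dicycle c, size c = n, c =i V
              & forall u v, e u v = (v == next c u)].

End Digraph.

(* Main.v *)
Require Import Defs.
From mathcomp Require Import all_boot all_fingroup zify.

(* A factor is a permutation s all of whose pairs (v, s v) are arcs. Hall's
   condition holds by the degree hypothesis, so a factor exists; take one with
   the fewest cycles. If u and v lie on the same side and on different cycles,
   then u -> s v and v -> s u cannot both be arcs, since composing s with a
   transposition would merge their cycles. Hence at most half of the possible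
   arcs between two cycles are present, and the degree sums leave only extremal
   configurations, which strong connectivity excludes: D is hamiltonian (or a
   directed cycle, if some vertex shares no neighbour with another one).
   On a hamiltonian cycle, a vertex of degree at least 2a - 1 lies on cycles of
   all even lengths by counting chords. If there is no such vertex, then all
   degrees are at least a + 2, and it suffices to find a cycle of length 2a - 2:
   a missed vertex is then on cycles of all smaller even lengths. If there were
   no such cycle, the same merging count would show that deleting two
   consecutive vertices x', x'' from ... x x' x'' r ... allows at most one way to
   close up the remaining path as two disjoint cycles, so that
   d^+(x) + d^-(r) <= a + 1; summing over x contradicts the degree condition. *)

Set Implicit Arguments.
Unset Strict Implicit.
Unset Printing Implicit Defensive.

(** * Hall's marriage theorem *)

Section Hall.

Variables (T U : finType) (r : T -> U -> bool) (y0 : U).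
Implicit Types (A S : {set T}) (B : {set U}).

Definition neighbours B S : {set U} := [set y in B | [exists x in S, r x y]].

(** Induction on the size of [A]. A tight nonempty proper [S] splits the problem into [S] and
    [A :\: S], the latter without [neighbours B S]. If no such [S] is tight, [x0] may take any of
    its neighbours, since the surplus absorbs the loss of one vertex. *)
Lemma hall_in A B :
  (forall S, S \subset A -> #|S| <= #|neighbours B S|) ->
  exists2 f : T -> U, {in A &, injective f} &
    forall x, x \in A -> (f x \in B) && r x (f x).
Proof.
have [n] := ubnP #|A|; elim: n => // n IHn in A B * => ltAn hallA.
have [->|[x0 Ax0]] := set_0Vmem A.
  (* [A] is empty, so [y0] is a mere default value. *)
  by exists (fun=> y0) => x; rewrite inE.
have [/existsP[S /and3P[S0 SA leS]] | noS] :=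
  boolP [exists S : {set T}, [&& S != set0, S \proper A & #|neighbours B S| <= #|S|]].
- have SsA := proper_sub SA.
  have [|S' S'S|f1 inj1 f1P] := IHn S B.
  + by have := proper_card SA; lia.
  + by apply: hallA; apply: subset_trans S'S SsA.
  have [||f2 inj2 f2P] := IHn (A :\: S) (B :\: neighbours B S).
  + rewrite cardsD (setIidPr SsA); move: S0; rewrite -card_gt0.
    have := subset_leq_card SsA; lia.
  + move=> S' S'A.
    have dis : S :&: S' = set0.
      apply/setP=> x; rewrite !inE; apply/negP=> /andP[Sx S'x].
      by have := subsetP S'A x S'x; rewrite inE Sx.
    have SUA : S :|: S' \subset A.
      by rewrite subUset SsA (subset_trans S'A) ?subsetDl.
    have := hallA _ SUA; rewrite cardsU dis cards0 subn0.
    have : neighbours B (S :|: S') \subset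
           neighbours B S :|: neighbours (B :\: neighbours B S) S'.
      apply/subsetP=> y; rewrite !inE => /andP[-> /existsP[x /andP[]]] /=.
      case: (boolP [exists x in S, r x y]) => //= noSy; rewrite inE.
      case/orP=> [Sx rxy|S'x rxy]; last by apply/existsP; exists x; rewrite S'x.
      by case/existsP: noSy; exists x; rewrite Sx.
    move/subset_leq_card; rewrite cardsU; lia.
  have f1N x : x \in S -> f1 x \in neighbours B S.
    move=> Sx; have /andP[Bf rf] := f1P x Sx; rewrite inE Bf.
    by apply/existsP; exists x; rewrite Sx.
  have f2N x : x \in A -> x \notin S -> f2 x \notin neighbours B S.
    move=> Ax Sx; have := f2P x; rewrite in_setD Sx Ax => /(_ isT).
    by rewrite in_setD => /andP[/andP[]].
  exists (fun x => if x \in S then f1 x else f2 x) => [x x' Ax Ax' | x Ax].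
  + case: ifP => Sx; case: ifP => Sx' eqf.
    * exact: inj1.
    * by have := f2N _ Ax' (negbT Sx'); rewrite -eqf f1N.
    * by have := f2N _ Ax (negbT Sx); rewrite eqf f1N.
    * by apply: inj2; rewrite // inE ?Sx ?Sx'.
  + case: ifP => Sx; first exact: f1P.
    by have := f2P x; rewrite !in_setD Sx Ax => /(_ isT) /andP[/andP[_ ->] ->].
have [y yN] : exists y, y \in neighbours B [set x0].
  by apply/card_gt0P; rewrite -(cards1 x0); apply: hallA; rewrite sub1set.
have [By rx0y] : y \in B /\ r x0 y.
  by move: yN; rewrite inE => /andP[-> /existsP[x /andP[/set1P-> ->]]].
have [||f injf fP] := IHn (A :\ x0) (B :\ y).
- by move: ltAn; rewrite (cardsD1 x0 A) Ax0; lia.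
- move=> S SA.
  have [->|[x1 Sx1]] := set_0Vmem S; first by rewrite cards0.
  have ltS : #|S| < #|neighbours B S|.
    rewrite ltnNge; apply: contra noS => leS; apply/existsP; exists S.
    rewrite leS andbT; apply/andP; split; first by apply/set0Pn; exists x1.
    by apply: sub_proper_trans SA (properD1 Ax0).
  have : neighbours B S :\ y \subset neighbours (B :\ y) S.
    by apply/subsetP=> z; rewrite !inE => /and3P[-> -> ->].
  move/subset_leq_card; move: ltS; rewrite (cardsD1 y (neighbours B S)).
  by case: (_ \in _); lia.
exists (fun x => if x == x0 then y else f x) => [x x' Ax Ax' | x Ax].
- have fy z : z \in A -> z != x0 -> f z != y.
    by move=> Az zx0; have := fP z; rewrite !inE zx0 Az => /(_ isT) /andP[/andP[]].
  case: eqP => [->|/eqP nx]; case: eqP => [->|/eqP nx'] // eqf.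
  + by have := fy _ Ax' nx'; rewrite -eqf eqxx.
  + by have := fy _ Ax nx; rewrite eqf eqxx.
  + by apply: injf; rewrite ?inE ?nx ?nx'.
- case: eqP => [->|/eqP nx]; first by rewrite By.
  by have := fP x; rewrite !inE nx Ax => /(_ isT) /andP[/andP[_ ->] ->].
Qed.

End Hall.

(** * Cycles of permutations *)

Section PermOrbits.

Variable V : finType.
Implicit Types (s t : {perm V}) (A : {set V}) (e : rel V).

Lemma closed_perm_mem s A :
  (forall v, v \in A -> s v \in A) -> forall v, (s v \in A) = (v \in A).
Proof.
move=> sA v; have sub : s @: A \subset A.
  by apply/subsetP=> _ /imsetP[w Aw ->]; apply: sA.
have /eqP eqA : s @: A == A by rewrite eqEcard sub (card_imset _ (@perm_inj _ s)) leqnn.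
by rewrite -{1}eqA (mem_imset _ _ (@perm_inj _ s)).
Qed.

Lemma mem_porbit1 s x v : (s v \in porbit s x) = (v \in porbit s x).
Proof.
by rewrite -!eq_porbit_mem -[s v]/((s ^+ 1)%g v) porbit_perm.
Qed.

Lemma porbit_closed_sub s A x :
  (forall v, v \in A -> s v \in A) -> x \in A -> porbit s x \subset A.
Proof.
move=> sA Ax; apply/subsetP=> _ /porbitP[i ->].
by rewrite permX; elim: i => //= i; apply: sA.
Qed.

(** If some [y] outside [A] were not in the orbit of [x], the orbits of [p], [x] and [y] would be
    three. *)
Lemma porbit_setC s A p x :
  (forall v, v \in A -> s v \in A) -> #|porbits s| <= 2 ->
  p \in A -> x \notin A -> porbit s x = ~: A.
Proof.
move=> sA le2 Ap Ax.
have sAE := closed_perm_mem sA.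
have sub y : y \notin A -> porbit s y \subset ~: A.
  by move=> Ay; apply: porbit_closed_sub => [v|]; rewrite !inE // sAE.
apply/eqP; rewrite eqEsubset sub //=; apply/subsetP=> y; rewrite inE => Ay.
apply: contraLR le2 => xy; rewrite -ltnNge.
have pN z : z \notin A -> porbit s z != porbit s p.
  move=> Az; apply: contra Az; rewrite eq_porbit_mem.
  exact: (subsetP (porbit_closed_sub sA Ap)).
have : [set porbit s y; porbit s x; porbit s p] \subset porbits s.
  by rewrite !subUset !sub1set !imset_f.
move/subset_leq_card; apply: leq_trans.
rewrite -setUA cardsU1 cardsU1 cards1 !inE !negb_or !pN // eq_porbit_mem xy.
by [].
Qed.

Lemma card_porbits_merge s x y :
  x \notin porbit s y -> #|porbits (tperm x y * s)%g| < #|porbits s|.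
Proof.
move=> xy; have := porbits_mul_tperm s x y; rewrite /= xy.
by case: (x != y) => /=; lia.
Qed.

Lemma card_porbits_tperm s x y :
  #|porbits (tperm x y * s)%g| <= #|porbits s|.+1.
Proof. by have := porbits_mul_tperm s x y => /=; case: (x != y) => /=; lia. Qed.

(** Taking images under [t] maps the orbits of [s] onto those of the conjugate. *)
Lemma card_porbits_conj s t : #|porbits (s ^ t)%g| <= #|porbits s|.
Proof.
have sub : porbits (s ^ t)%g \subset (fun C : {set V} => t @: C) @: porbits s.
  apply/subsetP=> _ /imsetP[x _ ->].
  apply/imsetP; exists (porbit s (t^-1%g x)); first by rewrite imset_f.
  have conjX i : ((s ^ t) ^+ i)%g x = t ((s ^+ i)%g (t^-1%g x)).
    by rewrite -conjXg conjgE !permM.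
  apply/setP=> y; apply/porbitP/imsetP => [[i ->]|[_ /porbitP[i ->] ->]].
    by exists ((s ^+ i)%g (t^-1%g x)); rewrite ?mem_porbit.
  by exists i.
by apply: leq_trans (subset_leq_card sub) (leq_imset_card _ _).
Qed.

Lemma iter_inj_porbit s x i j :
  i < #|porbit s x| -> j < #|porbit s x| -> iter i s x = iter j s x -> i = j.
Proof.
move=> lti ltj eqij; apply/eqP.
rewrite -(nth_uniq x _ _ (uniq_traject_porbit s x)) ?size_traject //.
by rewrite !nth_traject // eqij.
Qed.

Lemma porbit_iterP s x y :
  y \in porbit s x -> exists2 i, i < #|porbit s x| & y = iter i s x.
Proof. by rewrite porbit_traject => /trajectP. Qed.

Lemma uniq_traject_perm s x n : n <= #|porbit s x| -> uniq (traject s x n).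
Proof.
move=> le_n; rewrite -(take_traject s x le_n).
exact: take_uniq (uniq_traject_porbit s x).
Qed.

Lemma path_traject e s y k :
  (forall i, i < k -> e (iter i s y) (s (iter i s y))) ->
  path e y (traject s (s y) k).
Proof.
elim: k y => //= k IHk y ek; rewrite (ek 0) //=; apply: IHk => i ltik.
by have := ek i.+1 ltik; rewrite iterSr.
Qed.

Lemma dicycle_porbit e s x :
  (forall v, v \in porbit s x -> e v (s v)) -> 1 < #|porbit s x| ->
  dicycle e (traject s x #|porbit s x|).
Proof.
move=> es gt1; split; rewrite ?size_traject ?uniq_traject_porbit //.
have itx : iter #|porbit s x| s x = x by apply: iter_porbit.
case def_n: #|porbit s x| itx => [//|n] itx /=.
rewrite rcons_path last_traject path_traject /= => [|i _].
  rewrite -{2}itx iterS; apply: es; rewrite -permX; exact: mem_porbit.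
by apply: es; rewrite -permX mem_porbit.
Qed.

(** The shape of all cycles built below that are shorter than the Hamiltonian one: a stretch of an
    orbit, closed up through one further vertex, of total length [k.+2]. *)
Lemma dicycle_cons_traject e s v y k :
  (forall i, i < k -> e (iter i s y) (s (iter i s y))) ->
  k < #|porbit s y| -> v \notin traject s y k.+1 ->
  e v y -> e (iter k s y) v -> dicycle e (v :: traject s y k.+1).
Proof.
move=> es ltk vy evy eyv; split; first by rewrite /= ltnS.
  by rewrite cons_uniq vy uniq_traject_perm.
by rewrite /= evy rcons_path last_traject path_traject.
Qed.

End PermOrbits.

(** * Factors and directed cycles *)

Lemma pigeonhole_rel (T U : finType) (r : T -> U -> bool)
    (A : {set T}) (B : {set U}) :
  (forall x, x \in A -> exists2 y, y \in B & r x y) -> #|B| < #|A| ->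
  exists x x' y, [/\ x \in A, x' \in A, x != x', r x y & r x' y].
Proof.
move=> AB ltBA; pose f x := [pick y in B | r x y].
have [inj|/dinjectivePn[x Ax [x' /andP[x'x Ax'] eqf]]] := boolP (dinjectiveb f A).
  have sub : f @: A \subset Some @: B.
    apply/subsetP=> _ /imsetP[x Ax ->]; rewrite /f; case: pickP => [y|] /=.
      by case/andP=> By _; apply: imset_f.
    by have [y By rxy] := AB x Ax => /(_ y); rewrite By rxy.
  have := subset_leq_card sub.
  by rewrite (card_in_imset (dinjectiveP _ _ inj)) card_imset; [lia|apply: Some_inj].
have [y fx] : exists y, f x = Some y.
  rewrite /f; case: pickP => [y|] /=; first by exists y.
  by have [y By rxy] := AB x Ax => /(_ y); rewrite By rxy.
have rP z : f z = Some y -> r z y by rewrite /f; case: pickP => // y' /andP[_ ry'] [<-].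
by exists x, x', y; split; rewrite // ?(eq_sym x) ?rP // -eqf.
Qed.

Section Degrees.

Variables (V : finType) (e : rel V).
Implicit Types (u v w : V) (A B : {set V}).

Definition deg_to A u := \sum_(v in A) (e u v + e v u).

Lemma outdeg_sum u : outdeg e u = \sum_v e u v.
Proof. by rewrite /outdeg -sum1dep_card big_mkcond; apply: eq_bigr => v _; case: e. Qed.

Lemma indeg_sum u : indeg e u = \sum_v e v u.
Proof. by rewrite /indeg -sum1dep_card big_mkcond; apply: eq_bigr => v _; case: e. Qed.

Lemma deg_sum u : deg e u = \sum_v (e u v + e v u).
Proof. by rewrite /deg outdeg_sum indeg_sum big_split. Qed.

Lemma deg_toC A u : deg e u = deg_to A u + deg_to (~: A) u.
Proof.
rewrite deg_sum (bigID (mem A)) /=; congr (_ + _).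
by apply: eq_bigl => v; rewrite !inE.
Qed.

Lemma outdeg_le B u : (forall v, e u v -> v \in B) -> outdeg e u <= #|B|.
Proof. by move=> uB; apply/subset_leq_card/subsetP => v; rewrite inE; apply: uB. Qed.

Lemma indeg_le B u : (forall v, e v u -> v \in B) -> indeg e u <= #|B|.
Proof. by move=> uB; apply/subset_leq_card/subsetP => v; rewrite inE; apply: uB. Qed.

Lemma crossing_arc A x y : strongly_connected e -> x \in A -> y \notin A ->
  exists u v, [/\ u \in A, v \notin A & e u v].
Proof.
move=> strong; have /connectP[p] := strong x y.
elim: p x => /= [x _ -> ->|z p IHp x /andP[exz zp] lasty Ax Ay] //.
have [Az|Az] := boolP (z \in A); first exact: IHp zp lasty Az Ay.
by exists x, z.
Qed.

End Degrees.

(** * Existence of a factor, and the directed-cycle case *)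

Section Bipartite.

Variables (V : finType) (e : rel V) (c : V -> bool) (a : nat).
Implicit Types (u v w : V) (A B S : {set V}) (s t : {perm V}) (b : bool).

Definition side b : {set V} := [set v | c v == b].
Definition factor s := [forall v, e v (s v)].
(** Boolean form of the premise of the degree condition, so that having a partner can be decided. *)
Definition partner u v := (u != v) &&
  ([exists w, e w u && e w v] || [exists w, e u w && e v w]).

Hypothesis bip : forall u v, e u v -> c v = ~~ c u.
Hypothesis card_side : forall b, #|side b| = a.
Hypothesis strong : strongly_connected e.
Hypothesis a_ge3 : 3 <= a.
Hypothesis meyniel : forall u v, u != v ->
  common_in_neighbour e u v \/ common_out_neighbour e u v ->
  3 * a <= deg e u + deg e v.

Lemma out_side u v : e u v -> v \in side (~~ c u).
Proof. by move=> uv; rewrite inE (bip uv). Qed.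

Lemma in_side u v : e v u -> v \in side (~~ c u).
Proof. by move=> uv; rewrite inE (bip uv) negbK. Qed.

Lemma outdeg_le_side u : outdeg e u <= a.
Proof. by rewrite -(card_side (~~ c u)); apply/outdeg_le/out_side. Qed.

Lemma indeg_le_side u : indeg e u <= a.
Proof. by rewrite -(card_side (~~ c u)); apply/indeg_le => v; apply: in_side. Qed.

Lemma partner_sym u v : partner u v = partner v u.
Proof.
rewrite /partner eq_sym; congr (_ && (_ || _));
by apply: eq_existsb => w; rewrite andbC.
Qed.

Lemma meyniel_partner u v : partner u v -> 3 * a <= deg e u + deg e v.
Proof.
case/andP=> uv /orP[] /existsP[w /andP[wu wv]]; apply: meyniel => //.
  by left; exists w.
by right; exists w.
Qed.

Lemma partner_side u v : partner u v -> c u = c v.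
Proof.
case/andP=> _ /orP[] /existsP[w /andP[uw vw]]; first by rewrite (bip uw) (bip vw).
by apply: negb_inj; rewrite -(bip uw) -(bip vw).
Qed.

Lemma partner_in u v w : u != v -> e w u -> e w v -> partner u v.
Proof.
rewrite /partner => -> wu wv; apply/orP; left.
by apply/existsP; exists w; rewrite wu.
Qed.

Lemma partner_out u v w : u != v -> e u w -> e v w -> partner u v.
Proof.
rewrite /partner => -> wu wv; apply/orP; right.
by apply/existsP; exists w; rewrite wu.
Qed.

Lemma card_V : #|V| = 2 * a.
Proof.
rewrite -cardsT -(setUCr (side true)) cardsU setICr cards0 card_side.
have -> : ~: side true = side false.
  by apply/setP=> v; rewrite !inE; case: (c v).
by rewrite card_side subn0 mul2n addnn.
Qed.

Lemma ex_side b A : #|A| < a -> exists2 v, c v = b & v \notin A.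
Proof.
move=> ltA; have /subsetPn[v] : ~~ (side b \subset A).
  by apply: contraL ltA => /subset_leq_card; rewrite card_side -leqNgt.
by rewrite inE => /eqP cv Av; exists v.
Qed.

Lemma ex_out u : exists v, e u v.
Proof.
have [w _ wu] : exists2 v, c v = true & v \notin [set u].
  by apply: ex_side; rewrite cards1; lia.
have [_ [v [/set1P-> _ uv]]] := crossing_arc strong (set11 u) wu.
by exists v.
Qed.

Lemma ex_in u : exists v, e v u.
Proof.
have [w _ wu] : exists2 v, c v = true & v \notin [set u].
  by apply: ex_side; rewrite cards1; lia.
have wC : w \in [set~ u] by rewrite !inE in wu *.
have uC : u \notin [set~ u] by rewrite !inE eqxx.
have [v [u' [_ u'u vu]]] := crossing_arc strong wC uC.
by exists v; move: u'u; rewrite !inE negbK => /eqP <-.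
Qed.

(** If [N] is smaller than [S], two vertices of [S] share an out-neighbour, and their degrees are at
    most [#|N| + a]; hence [a <= 2 * #|N|]. Dually, two vertices of the opposite side outside [N]
    share an in-neighbour, and all their in-neighbours avoid [S]; hence [2 * #|S| <= a], a
    contradiction. *)
Lemma hall_side b S : S \subset side b -> #|S| <= #|neighbours e setT S|.
Proof.
move=> Sb; rewrite leqNgt; apply/negP; set N := neighbours _ _ _ => ltNS.
have mN u v : u \in S -> e u v -> v \in N.
  by move=> Su uv; rewrite inE in_setT; apply/existsP; exists u; rewrite Su.
have cS u : u \in S -> c u = b by move/(subsetP Sb); rewrite inE => /eqP.
have NC : N \subset side (~~ b).
  apply/subsetP=> v; rewrite inE => /andP[_ /existsP[u /andP[Su /out_side]]].
  by rewrite (cS u Su).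
have [x [x' [y [Sx Sx' xx' xy x'y]]]] :
    exists x x' y, [/\ x \in S, x' \in S, x != x', e x y & e x' y].
  apply: pigeonhole_rel ltNS => u Su; have [v uv] := ex_out u.
  by exists v => //; apply: mN uv.
have := meyniel_partner (partner_out xx' xy x'y).
have degS u : u \in S -> deg e u <= #|N| + a.
  by move=> Su; rewrite leq_add ?indeg_le_side // outdeg_le // => v; apply: mN.
have := degS _ Sx; have := degS _ Sx' => dx' dx d3.
have dC u v : u \in side (~~ b) :\: N -> e v u -> v \in side b :\: S.
  case/setDP; rewrite {1}inE => /eqP cu uN vu.
  have cv : c v = b by apply: negb_inj; rewrite -(bip vu).
  rewrite in_setD inE cv eqxx andbT; apply: contra uN => Sv.
  exact: mN vu.
have ltC : #|side b :\: S| < #|side (~~ b) :\: N|.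
  rewrite !cardsD !card_side (setIidPr Sb) (setIidPr NC).
  have := subset_leq_card NC; have := subset_leq_card Sb.
  by rewrite !card_side; lia.
have [z [z' [w [Cz Cz' zz' wz wz']]]] :
    exists z z' w, [/\ z \in side (~~ b) :\: N, z' \in side (~~ b) :\: N,
                     z != z', e w z & e w z'].
  apply: (@pigeonhole_rel _ _ (fun z w => e w z)) ltC => u Cu.
  by have [v vu] := ex_in u; exists v => //; apply: dC vu.
have := meyniel_partner (partner_in zz' wz wz').
have degC u : u \in side (~~ b) :\: N -> deg e u <= a + #|side b :\: S|.
  by move=> Cu; rewrite leq_add ?outdeg_le_side // indeg_le // => v; apply: dC.
have := degC _ Cz; have := degC _ Cz'.
rewrite cardsD card_side (setIidPr Sb).
by have := subset_leq_card Sb; rewrite card_side; lia.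
Qed.

Lemma ex_factor : exists s, factor s.
Proof.
have [v0 _ _] : exists2 v, c v = true & v \notin set0.
  by apply: ex_side; rewrite cards0; lia.
(* A set [S] splits along the two sides, and the neighbourhoods of its two pieces lie on opposite
   sides, so they are disjoint and [hall_side] can be applied to each piece. *)
have [|f injf fP] := @hall_in V V e v0 setT setT.
  move=> S _; pose Sb b := S :&: side b.
  have SbE b : #|Sb b| <= #|neighbours e setT (Sb b)|.
    by apply: hall_side (subsetIr _ _).
  have NbC b : neighbours e setT (Sb b) \subset neighbours e setT S :&: side (~~ b).
    apply/subsetP=> v; rewrite !inE => /existsP[u /andP[]].
    rewrite !inE => /andP[Su /eqP <-] uv; rewrite (bip uv) eqxx andbT.
    by apply/existsP; exists u; rewrite Su.
  rewrite -(cardsID (side true) S) -(cardsID (side false) (neighbours e setT S)).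
  have DC A : A :\: side true = A :&: side false.
    by apply/setP=> v; rewrite !inE; case: (c v) => //=; rewrite ?andbT ?andbF.
  have DC' A : A :\: side false = A :&: side true.
    by apply/setP=> v; rewrite !inE; case: (c v) => //=; rewrite ?andbT ?andbF.
  rewrite DC DC'; apply: leq_add.
    exact: leq_trans (SbE true) (subset_leq_card (NbC true)).
  exact: leq_trans (SbE false) (subset_leq_card (NbC false)).
have inj_f : injective f by move=> u v; apply: injf.
exists (perm inj_f); apply/forallP=> v; rewrite permE.
by have := fP v (in_setT v) => /andP[].
Qed.

Lemma partner_next s v w : factor s -> (forall u, ~~ partner v u) ->
  e v w -> w = s v.
Proof.
move=> /forallP es nov vw; apply/eqP/negPn/negP => wsv.
have /negP[] := nov (s^-1%g w); apply: (@partner_out _ _ w) => //.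
  by apply: contra wsv => /eqP->; rewrite permKV.
by have := es (s^-1%g w); rewrite permKV.
Qed.

(** Suppose [w = s v] had a partner [w']. Then [v] is the only in-neighbour of [w] and is not an
    in-neighbour of [w'], so the degree condition forces [w] to dominate the whole side of [v]. Thus
    [v] shares the in-neighbour [w] with another vertex, a contradiction. *)
Lemma no_partner_next s v : factor s ->
  (forall u, ~~ partner v u) -> forall u, ~~ partner (s v) u.
Proof.
move=> fs nov w'; have es := forallP fs; apply/negP => pw; set w := s v in pw.
have ww' : w != w' by case/andP: pw.
have inw : indeg e w <= 1.
  rewrite -(cards1 v); apply: indeg_le => u uw; apply/set1P/eqP/negPn/negP => uv.
  by have /negP[] := nov u; apply: (@partner_out _ _ w) => //; rewrite eq_sym.
have nvw' : ~~ e v w'.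
  by apply/negP => /(partner_next fs nov) w'E; rewrite w'E eqxx in ww'.
have inw' : indeg e w' < a.
  rewrite -(card_side (c v)) (cardsD1 v) inE eqxx add1n ltnS.
  apply: indeg_le => u uw'; rewrite !inE; apply/andP; split.
    by apply: contraNneq nvw' => <-.
  by rewrite -(negbK (c u)) -(bip uw') -(partner_side pw) (bip (es v)) negbK.
have outw : a <= outdeg e w.
  have := meyniel_partner pw; have := outdeg_le_side w'.
  by rewrite /deg; lia.
have wall u : c u = c v -> e w u.
  have /eqP sE : [set u | e w u] == side (c v).
    rewrite eqEcard card_side outw andbT; apply/subsetP=> z; rewrite inE.
    by move/out_side; rewrite (bip (es v)) negbK.
  by move=> cu; have : u \in side (c v); [rewrite inE cu | rewrite -sE inE].
have [v2 cv2 v2v] : exists2 v2, c v2 = c v & v2 \notin [set v].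
  by apply: ex_side; rewrite cards1; lia.
have /negP[] := nov v2; apply: (@partner_in _ _ w); rewrite ?wall //.
by move: v2v; rewrite inE eq_sym.
Qed.

Lemma directed_cycle_or_partner s : factor s ->
  is_directed_cycle e (2 * a) \/ forall v, exists u, partner v u.
Proof.
move=> fs; have es := forallP fs.
have [/forallP allp|] := boolP [forall v, exists u, partner v u].
  by right=> v; apply/existsP; apply: allp.
rewrite negb_forall => /existsP[v0]; rewrite negb_exists => /forallP nov0.
left.
(* Lack of partners passes along arcs, so strong connectivity spreads it from [v0] to all vertices;
   then only the arcs of [s] remain. *)
have nov u v : ~~ partner v u.
  have /connectP[p pth ->] := strong v0 v.
  elim: p v0 nov0 pth u => //= w p IHp v1 nov1 /andP[v1w pth] u.
  apply: IHp => // u'; rewrite (partner_next fs nov1 v1w).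
  exact: no_partner_next fs nov1 u'.
have eE u v : e u v = (v == s u).
  by apply/idP/eqP => [|->]; [apply: partner_next | apply: es].
have orbV : porbit s v0 = [set: V].
  apply/setP=> v; rewrite inE; have /connectP[p pth ->] := strong v0 v.
  elim: p v0 {nov0} pth => [v1 _ | w p IHp v1 /= /andP[]]; first exact: porbit_id.
  by rewrite eE => /eqP-> /IHp; rewrite -[s v1]/((s ^+ 1)%g v1) porbit_perm.
have card_orb : #|porbit s v0| = 2 * a by rewrite orbV cardsT card_V.
have cyc : dicycle e (traject s v0 #|porbit s v0|).
  by apply: dicycle_porbit => [v _|]; rewrite ?es // card_orb; lia.
have allC v : v \in traject s v0 #|porbit s v0| by rewrite -porbit_traject orbV inE.
exists (traject s v0 #|porbit s v0|); split; first exact: cyc.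
- by rewrite size_traject.
- by move=> v; rewrite allC.
move=> u v; rewrite eE; congr (_ == _).
by case: cyc => _ _ /next_cycle => /(_ _ (allC u)); rewrite eE => /eqP.
Qed.
End Bipartite.

(** * Counting arcs between unmergeable parts *)

Lemma sum_nat_max_eq (I : finType) (A : {set I}) (F : I -> nat) M :
  (forall i, i \in A -> F i <= M) -> M * #|A| <= \sum_(i in A) F i ->
  forall i, i \in A -> F i = M.
Proof.
move=> FM sumF i Ai; apply/eqP; rewrite eqn_leq FM //=.
move: sumF; rewrite (bigD1 i) //= (cardsD1 i) Ai.
have : \sum_(j in A | j != i) F j <= M * #|A :\ i|.
  rewrite mulnC -sum_nat_const [leqRHS](eq_bigl (fun j => (j \in A) && (j != i))).
    by apply: leq_sum => j /andP[Aj _]; apply: FM.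
  by move=> j; rewrite !inE andbC.
lia.
Qed.

(** If some [F i] is below [k / 2], every other term is at least [k - F i], which is above [k / 2];
    one such term makes up for the deficit of [i]. *)
Lemma sum_nat_pairs_ge (I : finType) (A : {set I}) (F : I -> nat) k :
  (forall i j, i \in A -> j \in A -> i != j -> k <= F i + F j) ->
  1 < #|A| -> k * #|A| <= 2 * \sum_(i in A) F i.
Proof.
move=> Fk gt1.
have [/existsP[i /andP[Ai ltk]]|] := boolP [exists i in A, 2 * F i < k].
  rewrite (bigD1 i) //=; move: gt1; rewrite (cardsD1 i) Ai.
  have : (k - F i) * #|A :\ i| <= \sum_(j in A | j != i) F j.
    rewrite mulnC -sum_nat_const (eq_bigl (fun j => (j \in A) && (j != i))).
      apply: leq_sum => j /andP[Aj ji]; rewrite leq_subLR.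
      by apply: Fk; rewrite // eq_sym.
    by move=> j; rewrite !inE andbC.
  nia.
rewrite negb_exists => /forallP noi.
rewrite mulnC -sum_nat_const big_distrr; apply: leq_sum => i Ai.
by have := noi i; rewrite Ai /= -leqNgt.
Qed.

Section Counting.

Variables (V : finType) (e : rel V) (c : V -> bool) (a : nat).
Implicit Types (u v w : V) (A B C K S : {set V}) (s t : {perm V}) (b : bool).

Notation side := (side c).
Hypothesis bip : forall u v, e u v -> c v = ~~ c u.
Hypothesis card_side : forall b, #|side b| = a.

Definition alternating s A := forall v, v \in A -> s v \in A /\ c (s v) = ~~ c v.
Definition complete A := forall u v, u \in A -> v \in A -> c v = ~~ c u -> e u v.

Lemma full_out u v : a <= outdeg e u -> c v = ~~ c u -> e u v.
Proof.
move=> ge_a cv.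
have /eqP sE : [set w | e u w] == side (~~ c u).
  rewrite eqEcard card_side ge_a andbT; apply/subsetP=> w; rewrite inE.
  exact: out_side.
by have : v \in side (~~ c u); [rewrite inE cv | rewrite -sE inE].
Qed.

Lemma full_in u v : a <= indeg e u -> c v = ~~ c u -> e v u.
Proof.
move=> ge_a cv.
have /eqP sE : [set w | e w u] == side (~~ c u).
  rewrite eqEcard card_side ge_a andbT; apply/subsetP=> w; rewrite inE.
  exact: in_side.
by have : v \in side (~~ c u); [rewrite inE cv | rewrite -sE inE].
Qed.

Lemma deg_le u : deg e u <= 2 * a.
Proof.
by rewrite mul2n -addnn; rewrite leq_add ?(outdeg_le_side bip) ?(indeg_le_side bip).
Qed.

Lemma full_arcs u v : deg e u = 2 * a -> c v = ~~ c u -> e u v /\ e v u.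
Proof.
have := outdeg_le_side bip card_side u; have := indeg_le_side bip card_side u.
rewrite /deg => ? ? ? ?; split; [apply: full_out | apply: full_in] => //; lia.
Qed.

Lemma card_setI_side A b : #|A :&: side b| = \sum_(v in A) (c v == b).
Proof.
rewrite -sum1_card big_mkcond [RHS]big_mkcond; apply: eq_bigr => v _.
by rewrite !inE; case: (v \in A) => //=; case: (c v == b).
Qed.

Lemma arcs_le u v : e u v + e v u <= 2 * (c v == ~~ c u).
Proof.
have [uv|nuv] := boolP (e u v); first by rewrite (bip uv) eqxx; case: (e v u).
by have [vu|//] := boolP (e v u); rewrite (bip vu) negbK eqxx.
Qed.

Lemma deg_to_le A u : deg_to e A u <= 2 * #|A :&: side (~~ c u)|.
Proof.
by rewrite card_setI_side big_distrr; apply: leq_sum => v _; apply: arcs_le.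
Qed.

Lemma card_A_side A b : #|A| = #|A :&: side b| + #|A :&: side (~~ b)|.
Proof.
rewrite -(cardsID (side b) A); congr (_ + #|pred_of_set _|).
by apply/setP=> v; rewrite !inE; case: (c v) b => [] []; rewrite ?andbT ?andbF.
Qed.

Lemma alternating_mem s A : alternating s A -> forall v, (s v \in A) = (v \in A).
Proof. by move=> alt; apply: closed_perm_mem => v /alt[]. Qed.

(** [s] maps each half of [A] injectively into the other. *)
Lemma alternating_balanced s A b : alternating s A ->
  #|A :&: side b| = #|A :&: side true|.
Proof.
move=> alt; have le b' : #|A :&: side b'| <= #|A :&: side (~~ b')|.
  rewrite -(card_imset _ (@perm_inj _ s)); apply/subset_leq_card/subsetP.
  move=> _ /imsetP[v + ->]; rewrite !inE => /andP[/alt[-> ->] /eqP->].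
  by rewrite eqxx.
case: b => //; apply/eqP; rewrite eqn_leq; apply/andP; split; first exact: (le false).
exact: (le true).
Qed.

Lemma alternating_card s A : alternating s A -> #|A| = 2 * #|A :&: side true|.
Proof.
by move=> alt; rewrite (card_A_side A true) (alternating_balanced _ alt) mul2n addnn.
Qed.

Lemma sum_deg_to_self s C : alternating s C ->
  \sum_(u in C) deg_to e C u <= 4 * #|C :&: side true| ^ 2.
Proof.
move=> alt; set m := #|_|.
have -> : 4 * m ^ 2 = #|C| * (2 * m) by rewrite (alternating_card alt) -/m; lia.
rewrite -sum_nat_const; apply: leq_sum => u _.
by rewrite (leq_trans (deg_to_le _ _)) // (alternating_balanced _ alt).
Qed.

(* For u in C and v in K on the same side, at most one of the arcs
   u -> s v and v -> s u is present; these pairs of arcs exhaust the possible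
   arcs between C and K. *)
Lemma sum_deg_to_cross s C K : alternating s C -> alternating s K ->
  (forall u v, u \in C -> v \in K -> c u = c v -> ~~ (e u (s v) && e v (s u))) ->
  \sum_(u in C) deg_to e K u <= 2 * (#|C :&: side true| * #|K :&: side true|).
Proof.
move=> altC altK noM; set m := #|C :&: _|; set k := #|K :&: _|.
have -> : 2 * (m * k) = #|C| * k by rewrite (alternating_card altC) -/m; lia.
have inner u : \sum_(v in K) e u v = \sum_(v in K) e u (s v).
  rewrite (reindex_inj (@perm_inj _ s)) /=; apply: eq_bigl => v.
  exact: alternating_mem.
have outer : \sum_(u in C) \sum_(v in K) e v u = \sum_(u in C) \sum_(v in K) e v (s u).
  rewrite (reindex_inj (@perm_inj _ s)) /=; apply: eq_bigl => v.
  exact: alternating_mem.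
rewrite -sum_nat_const /deg_to.
under eq_bigr do rewrite big_split /=.
rewrite big_split outer /= -big_split /=; apply: leq_sum => u Cu.
rewrite inner -big_split /= /k -(alternating_balanced (c u) altK) card_setI_side.
apply: leq_sum => v Kv; have [cuv|cuv] := eqVneq (c v) (c u).
  by have := noM u v Cu Kv (esym cuv); case: (e u _) (e v _) => [] [].
case: (boolP (e u (s v))) => [/bip|_].
  by rewrite (altK _ Kv).2 => /negb_inj/eqP; rewrite (negbTE cuv).
case: (boolP (e v (s u))) => [/bip|_ //].
by rewrite (altC _ Cu).2 => /negb_inj/eqP; rewrite eq_sym (negbTE cuv).
Qed.

(** The sum is as large as possible, so every vertex of [A] attains the maximal degree into [A], and
    then every pair on opposite sides carries both arcs. *)
Lemma complete_of_sum s A : alternating s A ->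
  4 * #|A :&: side true| ^ 2 <= \sum_(u in A) deg_to e A u -> complete A.
Proof.
move=> alt; set m := #|_| => sumA u v Au Av cv.
have degA : deg_to e A u = 2 * m.
  apply: (sum_nat_max_eq (A := A)) => // [w Aw|].
    by rewrite (leq_trans (deg_to_le _ _)) // (alternating_balanced _ alt).
  by rewrite (alternating_card alt) -/m; lia.
have := @sum_nat_max_eq _ (A :&: side (~~ c u)) (fun w => e u w + e w u) 2.
move=> /(_ _ _ v); rewrite !inE Av cv eqxx => /(_ _ _ isT) H.
suff : e u v + e v u = 2 by case: (e u v) => //; case: (e v u).
apply: H => [w _|]; first by case: (e u w) (e w u) => [] [].
rewrite (alternating_balanced _ alt) -/m -degA /deg_to.
rewrite [leqRHS](eq_bigl (fun w => (w \in A) && (c w == ~~ c u))); last first.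
  by move=> w; rewrite !inE.
rewrite (bigID (fun w => c w == ~~ c u)) /= [X in _ + X]big1 ?addn0 // => w.
by case/andP=> _ /negbTE cw; have := arcs_le u w; rewrite cw muln0 leqn0 => /eqP.
Qed.

End Counting.

(** * Hamiltonicity *)

Section Hamiltonicity.

Variables (V : finType) (e : rel V) (c : V -> bool) (a : nat).
Implicit Types (u v w : V) (A B C K S : {set V}) (s t : {perm V}) (b : bool).

Notation side := (side c).
Hypothesis bip : forall u v, e u v -> c v = ~~ c u.
Hypothesis card_side : forall b, #|side b| = a.
Hypothesis strong : strongly_connected e.
Hypothesis a_ge3 : 3 <= a.
Hypothesis meyniel : forall u v, u != v ->
  common_in_neighbour e u v \/ common_out_neighbour e u v ->
  3 * a <= deg e u + deg e v.
Hypothesis has_partner : forall v, exists u, partner e v u.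

Definition min_factor s :=
  factor e s /\ forall t, factor e t -> #|porbits s| <= #|porbits t|.

Lemma deg_ge v : a <= deg e v.
Proof.
have [u /(meyniel_partner meyniel)] := has_partner v.
by have := deg_le bip card_side u; lia.
Qed.

Lemma ex_min_factor : exists s, min_factor s.
Proof.
have [s0 fs0] := ex_factor bip card_side strong a_ge3 meyniel.
pose s := [arg min_(t < s0 | factor e t) #|porbits t|].
by exists s; rewrite /s; case: arg_minnP => // t ft tmin.
Qed.

Lemma min_factor_unmergeable s u v : min_factor s -> u \notin porbit s v ->
  ~~ (e u (s v) && e v (s u)).
Proof.
case=> /forallP es smin uv; apply/negP => /andP[usv vsu].
have : factor e (tperm u v * s)%g.
  by apply/forallP=> w; rewrite permM; case: tpermP => [->|->|_ _].
by move/smin; rewrite leqNgt card_porbits_merge.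
Qed.

Lemma factor_side s v : factor e s -> c (s v) = ~~ c v.
Proof. by move/forallP=> /(_ v) /bip. Qed.

Lemma factor_alternating s A : factor e s -> (forall v, v \in A -> s v \in A) ->
  alternating c s A.
Proof. by move=> fs sA v Av; rewrite sA // factor_side. Qed.

(** Without common neighbours, the out-degrees of [u] and [u'] add up to at most [a], and so do the
    in-degrees. As both degrees are at least [a], both equal [a] and the two out-neighbourhoods
    cover the opposite side. So [w] shares an out-neighbour with [u] or [u'], which gives it degree
    at least [3 * a - a]. *)
Lemma full_others u u' w : u != u' -> c u = c u' -> ~~ partner e u u' ->
  w != u -> w != u' -> c w = c u -> deg e w = 2 * a.
Proof.
move=> uu' cuu' npart wu wu' cw.
have noin z : ~~ (e z u && e z u').
  by apply: contra npart => /andP[zu zu']; apply: partner_in zu zu'.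
have noout z : ~~ (e u z && e u' z).
  by apply: contra npart => /andP[zu zu']; apply: partner_out zu zu'.
have sumo : outdeg e u + outdeg e u' <= a.
  rewrite -(card_side (~~ c u)) -cardsUI [X in _ + X](_ : _ = 0) ?addn0.
    apply/subset_leq_card/subsetP => z; rewrite in_setU !inE => /orP[] /bip ->;
    by rewrite ?cuu' eqxx.
  apply/eqP; rewrite cards_eq0; apply/eqP/setP => z.
  by rewrite in_setI !in_set (negbTE (noout z)).
have sumi : indeg e u + indeg e u' <= a.
  rewrite -(card_side (~~ c u)) -cardsUI [X in _ + X](_ : _ = 0) ?addn0.
    apply/subset_leq_card/subsetP => z; rewrite in_setU !inE.
    by case/orP=> /bip; rewrite -?cuu' => ->; rewrite negbK eqxx.
  apply/eqP; rewrite cards_eq0; apply/eqP/setP => z.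
  by rewrite in_setI !in_set (negbTE (noin z)).
have := deg_ge u; have := deg_ge u'.
have dE v : deg e v = outdeg e v + indeg e v by [].
rewrite (dE u) (dE u') => du' du.
have [z wz] := ex_out card_side strong a_ge3 w.
have /eqP cover : [set z | e u z] :|: [set z | e u' z] == side (~~ c u).
  rewrite eqEcard; apply/andP; split.
    by apply/subsetP => y; rewrite in_setU !inE => /orP[] /bip ->; rewrite ?cuu' eqxx.
  rewrite card_side cardsU [X in _ - X](_ : _ = 0).
    by rewrite -/(outdeg e u) -/(outdeg e u'); lia.
  apply/eqP; rewrite cards_eq0; apply/eqP/setP => y.
  by rewrite in_setI !in_set (negbTE (noout y)).
have : z \in side (~~ c u) by rewrite inE (bip wz) cw.
rewrite -cover in_setU !in_set => /orP[] uz.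
  have := meyniel_partner meyniel (partner_out wu wz uz).
  by have := deg_le bip card_side w; rewrite ?(dE u) ?(dE u'); lia.
have := meyniel_partner meyniel (partner_out wu' wz uz).
by have := deg_le bip card_side w; rewrite ?(dE u) ?(dE u'); lia.
Qed.

Lemma full_merge s u v : min_factor s -> c u = c v ->
  deg e u = 2 * a -> deg e v = 2 * a -> u \in porbit s v.
Proof.
move=> ms cuv du dv; apply/negPn/negP => /(min_factor_unmergeable ms)/negP[].
apply/andP; split.
  by apply: (full_arcs bip card_side du _).1; rewrite factor_side ?cuv //; case: ms.
by apply: (full_arcs bip card_side dv _).1; rewrite factor_side ?cuv //; case: ms.
Qed.

(** All vertices on this side other than [u] and [u'] have full degree and lie on the cycle of [f].
    If [u] did not, any arc at [u] to or from that cycle could be used for a merge, and the arcs of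
    [s] at [u'] are excluded as [u] and [u'] share no neighbour. This leaves [u] with degree at most
    2. *)
Lemma nonpartner_porbit s u u' f : min_factor s ->
  u != u' -> c u = c u' -> ~~ partner e u u' ->
  c f = c u -> f != u -> f != u' -> u \in porbit s f.
Proof.
move=> ms uu' cuu' npart cf fu fu'; apply/negPn/negP => uf.
have fs : factor e s by case: ms.
have es := forallP fs.
have full w : c w = c u -> w != u -> w != u' -> deg e w = 2 * a.
  by move=> cw wu wu'; apply: full_others npart wu wu' cw.
have sep w : c w = c u -> w != u -> w != u' -> u \notin porbit s w.
  move=> cw wu wu'; apply: contra uf; rewrite -!eq_porbit_mem => /eqP->.
  by rewrite eq_porbit_mem; apply: full_merge => //; rewrite ?full ?cw.
have out1 : outdeg e u <= 1.
  rewrite -(cards1 (s u)); apply: outdeg_le => z uz; apply/set1P.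
  have [w zE] : exists w, z = s w by exists (s^-1%g z); rewrite permKV.
  have cw : c w = c u.
    by apply: negb_inj; rewrite -(factor_side w fs) -zE (bip uz).
  have [<-//|wu] := eqVneq w u; have [wu'|wu'] := eqVneq w u'.
    by case/negP: npart; apply: partner_out uz _ => //; rewrite zE wu'.
  have /negP[] := min_factor_unmergeable ms (sep w cw wu wu').
  rewrite -zE uz; apply: (full_arcs bip card_side (full _ cw wu wu') _).1.
  by rewrite factor_side // cw.
have in1 : indeg e u <= 1.
  rewrite -(cards1 (s^-1%g u)); apply: indeg_le => z zu; apply/set1P.
  apply: (@perm_inj _ s); rewrite permKV; set w := s z.
  have cw : c w = c u by rewrite (factor_side z fs) (bip zu).
  have [//|wu] := eqVneq w u; have [wu'|wu'] := eqVneq w u'.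
    by case/negP: npart; apply: partner_in zu _ => //; rewrite -wu'.
  (* Here the merge is applied to the predecessors [z] of [w] and [z0] of [u]: the arc from [z] to
     [u] is given, and the one from [z0] to [w] exists since [w] has full degree. *)
  set z0 := s^-1%g u; have z0E : s z0 = u by rewrite permKV.
  have zz0 : z0 \notin porbit s z.
    apply: contra (sep w cw wu wu'); rewrite -!eq_porbit_mem => /eqP E.
    rewrite -z0E eq_porbit_mem mem_porbit1 -eq_porbit_mem E.
    by rewrite -[w]/((s ^+ 1)%g z) porbit_perm.
  have /negP[] := min_factor_unmergeable ms zz0.
  rewrite z0E zu andbT.
  have cz0 : c u = ~~ c z0 by rewrite -(factor_side z0 fs) z0E.
  apply: (full_arcs bip card_side (full _ cw wu wu') _).2.
  by rewrite cw cz0 negbK.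
by have := deg_ge u; rewrite /deg; lia.
Qed.

(** Since [3 <= a], a third vertex [f] exists on this side; its cycle contains the whole side, and
    with it all predecessors. *)
Lemma nonpartner_hamiltonian s u u' : min_factor s ->
  u != u' -> c u = c u' -> ~~ partner e u u' -> forall x y, x \in porbit s y.
Proof.
move=> ms uu' cuu' npart.
have [f cf] : exists2 f, c f = c u & f \notin [set u; u'].
  by apply: ex_side => //; rewrite cards2 uu'; lia.
rewrite !inE negb_or => /andP[fu fu'].
have fs : factor e s by case: ms.
have allf_side g : c g = c u -> g \in porbit s f.
  move=> cg; have [->|gu] := eqVneq g u.
    exact: nonpartner_porbit ms uu' cuu' npart cf fu fu'.
  have [->|gu'] := eqVneq g u'.
    apply: (@nonpartner_porbit _ _ u) => //; rewrite ?(eq_sym u') -?cuu' //.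
    by rewrite partner_sym.
  apply: full_merge => //; first by rewrite cg.
    exact: full_others npart gu gu' cg.
  exact: full_others npart fu fu' cf.
have allf g : g \in porbit s f.
  have [/allf_side//|cg] := eqVneq (c g) (c u).
  rewrite -mem_porbit1; apply: allf_side; rewrite factor_side //.
  by case: (c g) (c u) cg => [] [].
by move=> x y; rewrite -eq_porbit_mem; apply/eqP;
  transitivity (porbit s f); apply/eqP; rewrite eq_porbit_mem // porbit_sym.
Qed.

End Hamiltonicity.

(** * Degree sums over unmergeable unions of cycles *)

Section PairSums.

Variables (V : finType) (e : rel V) (c : V -> bool) (a : nat).
Implicit Types (u v w : V) (A B C K S : {set V}) (s t : {perm V}) (b : bool).

Notation side := (side c).
Hypothesis bip : forall u v, e u v -> c v = ~~ c u.
Hypothesis card_side : forall b, #|side b| = a.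
Hypothesis a_ge3 : 3 <= a.
Hypothesis deg_ge : forall v, a <= deg e v.
Hypothesis pairs : forall u v, u != v -> c u = c v -> 3 * a <= deg e u + deg e v.

Lemma sum_deg_ge s C : alternating c s C -> 1 < #|C :&: side true| ->
  3 * a * #|C :&: side true| <= \sum_(u in C) deg e u.
Proof.
move=> alt gt1.
have half b : 3 * a * #|C :&: side true| <= 2 * \sum_(u in C :&: side b) deg e u.
  rewrite -(alternating_balanced b alt); apply: sum_nat_pairs_ge.
    move=> u v; rewrite !inE => /andP[_ /eqP cu] /andP[_ /eqP cv] uv.
    by apply: pairs; rewrite ?cu.
  by rewrite (alternating_balanced b alt).
have -> : \sum_(u in C) deg e u =
    \sum_(u in C :&: side true) deg e u + \sum_(u in C :&: side false) deg e u.
  rewrite (bigID (fun u => c u == true)) /=; congr (_ + _); apply: eq_bigl => u.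
    by rewrite !inE.
  by rewrite !inE; case: (c u).
by have := half true; have := half false; lia.
Qed.

Lemma alternating_setC s C : factor e s -> alternating c s C -> alternating c s (~: C).
Proof.
move=> fs alt v; rewrite !inE (alternating_mem alt) => Cv.
by rewrite Cv (factor_side bip).
Qed.

Lemma card_half_setC C : #|C :&: side true| + #|(~: C) :&: side true| = a.
Proof.
rewrite -(card_side true) -(cardsID C (side true)) setIC; congr (_ + #|pred_of_set _|).
by apply/setP=> v; rewrite !inE.
Qed.

Lemma sum_deg_le s C : alternating c s C -> alternating c s (~: C) ->
  (forall u v, u \in C -> v \notin C -> c u = c v -> ~~ (e u (s v) && e v (s u))) ->
  \sum_(u in C) deg e u <= 
    \sum_(u in C) deg_to e C u
    + 2 * (#|C :&: side true| * #|(~: C) :&: side true|).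
Proof.
move=> altC altC' noM.
under eq_bigr do rewrite (deg_toC e C).
rewrite big_split leq_add2l; apply: (sum_deg_to_cross bip altC altC') => u v Cu.
by rewrite inE; apply: noM.
Qed.

Lemma unmergeable_setC s C :
  (forall u v, u \in C -> v \notin C -> c u = c v -> ~~ (e u (s v) && e v (s u))) ->
  forall u v, u \in ~: C -> v \notin ~: C -> c u = c v -> ~~ (e u (s v) && e v (s u)).
Proof.
move=> noM u v; rewrite !inE negbK => Cu Cv cuv; rewrite andbC.
by apply: noM; rewrite ?cuv.
Qed.

(* A 2-cycle {x, s x} that cannot be merged with the rest has both degrees equal
   to a + 1, so that all remaining degrees are at least 2a - 1. *)
Lemma complete_two_cycle s C : factor e s ->
  alternating c s C -> alternating c s (~: C) ->
  (forall u v, u \in C -> v \notin C -> c u = c v -> ~~ (e u (s v) && e v (s u))) ->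
  #|C :&: side true| = 1 -> complete e c C /\ complete e c (~: C).
Proof.
move=> fs alt alt' noM m1; have es := forallP fs.
have uniqC u v : u \in C -> v \in C -> c u = c v -> u = v.
  move=> Cu Cv cuv; have := alternating_balanced (c u) alt; rewrite m1 => /eqP/cards1P[z zE].
  have : u \in C :&: side (c u) by rewrite !inE Cu eqxx.
  have : v \in C :&: side (c u) by rewrite !inE Cv cuv eqxx.
  by rewrite zE => /set1P-> /set1P->.
split=> [u v Cu Cv cv|].
  rewrite (uniqC v (s u)) // ?(alt _ Cu).1 //.
  by rewrite (factor_side bip).
have [x Cx] : exists x, x \in C.
  by have /card_gt0P[x] : 0 < #|C :&: side true|; rewrite ?m1 // inE => /andP[Cx _]; exists x.
set y := s x; have Cy : y \in C by rewrite (alt x Cx).1.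
have cy : c y = ~~ c x by rewrite (factor_side bip).
have yx : y != x by apply: contraTneq isT => yx; move: cy; rewrite yx; case: (c x).
have CE : C = [set x; y].
  apply/setP=> z; rewrite !inE; apply/idP/orP => [Cz|[]/eqP-> //].
  have [czx|czx] := eqVneq (c z) (c x); first by left; apply/eqP/uniqC.
  by right; apply/eqP/uniqC => //; rewrite cy; case: (c z) (c x) czx => [] [].
have sy : s y = x by apply: uniqC; rewrite ?(alt _ Cy).1 // (factor_side bip) // cy negbK.
have m2 : #|~: C :&: side true| = a.-1 by have := card_half_setC C; rewrite m1; lia.
(* At most 4 comes from inside [C], and at most [2 * (a - 1)] from crossing arcs. *)
have dxy : deg e x + deg e y <= 2 * (a + 1).
  have := sum_deg_le alt alt' noM; have := sum_deg_to_self bip alt.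
  have -> : \sum_(u in C) deg e u = deg e x + deg e y.
    by rewrite CE big_setU1 ?inE 1?eq_sym // big_set1.
  by rewrite m1 m2; lia.
(* If [u] had degree [a], all other vertices on its side would have degree [2 * a]; then [v] would
   have degree [2 * a] too, and [3 * a] exceeds [2 * (a + 1)]. *)
have not_a u v : u \in C -> v \in C -> c v = ~~ c u -> 
    deg e u + deg e v <= 2 * (a + 1) -> deg e u != a.
  move=> Cu Cv cv duv; apply/eqP => dua.
  have vall w : c w = ~~ c v -> e v w + e w v = 2.
    rewrite cv negbK => cw.
    have [->|wu] := eqVneq w u.
      have svu : s v = u.
        by apply: uniqC; rewrite ?(alt _ Cv).1 ?(factor_side bip) ?cv ?negbK.
      have suv : s u = v by apply: uniqC; rewrite ?(alt _ Cu).1 ?(factor_side bip) ?cv.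
      by have := es v; have := es u; rewrite suv svu => -> ->.
    have dw : deg e w = 2 * a.
      by have := pairs wu cw; have := deg_le bip card_side w; lia.
    by have [-> ->] := full_arcs bip card_side dw (etrans cv (congr1 negb (esym cw))).
  have : deg e v = 2 * a.
    rewrite deg_sum (bigID (fun w => c w == ~~ c v)) /= [X in _ + X]big1 => [|w cw].
      rewrite addn0 (eq_bigr (fun=> 2)) => [|w /eqP/vall //].
      rewrite sum_nat_const mulnC -(card_side (~~ c v)); congr (2 * _).
      by apply: eq_card => w; rewrite !inE.
    by have := arcs_le bip v w; rewrite (negbTE cw) muln0 leqn0 => /eqP.
  lia.
have dx : deg e x != a by apply: (not_a x y).
have dy : deg e y != a by apply: (not_a y x); rewrite ?cy ?negbK // addnC.
have dC w : w \in ~: C -> 2 * a - 1 <= deg e w.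
  rewrite inE => Cw.
  have := deg_ge x; have := deg_ge y => ? ?.
  have [cw|cw] := eqVneq (c w) (c x).
    by have := @pairs w x _ cw; rewrite (contraNneq _ Cw) => [/(_ isT)|->//]; lia.
  have {}cw : c w = c y by rewrite cy; case: (c w) (c x) cw => [] [].
  by have := @pairs w y _ cw; rewrite (contraNneq _ Cw) => [/(_ isT)|->//]; lia.
apply: (complete_of_sum bip alt').
have := sum_deg_le alt' _ (unmergeable_setC noM); rewrite setCK => /(_ alt).
rewrite m1 m2 muln1.
have : #|~: C| * (2 * a - 1) <= \sum_(u in ~: C) deg e u.
  by rewrite -sum_nat_const; apply: leq_sum.
rewrite (alternating_card alt') m2.
have -> : a = a.-1.+1 by lia.
set k := a.-1; rewrite /=; nia.
Qed.

(** Let [m] and [m'] be half the sizes of [C] and its complement. Unless one of them is 1, comparing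
    degree sums gives [3 * a <= 4 * m + 2 * m'] and the same with [m] and [m'] exchanged. As
    [m + m' = a], both are equalities with [m = m'], so the inner sums are maximal. *)
Lemma complete_halves s C : factor e s ->
  alternating c s C -> alternating c s (~: C) ->
  (forall u v, u \in C -> v \notin C -> c u = c v -> ~~ (e u (s v) && e v (s u))) ->
  0 < #|C :&: side true| -> 0 < #|~: C :&: side true| ->
  complete e c C /\ complete e c (~: C).
Proof.
move=> fs alt alt' noM m_gt0 m'_gt0.
have [m1|m_n1] := eqVneq #|C :&: side true| 1.
  exact: complete_two_cycle fs alt alt' noM m1.
have [m1|m'_n1] := eqVneq #|~: C :&: side true| 1.
  have := complete_two_cycle fs alt' _ (unmergeable_setC noM) m1.
  by rewrite setCK => /(_ alt)[].
have card2 := card_half_setC C.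
have leC := sum_deg_le alt alt' noM.
have leC' := sum_deg_le alt' _ (unmergeable_setC noM).
rewrite setCK in leC'; have {}leC' := leC' alt.
have geC : _ <= _ := sum_deg_ge alt _.
have geC' : _ <= _ := sum_deg_ge alt' _.
have selfC := sum_deg_to_self bip alt.
have selfC' := sum_deg_to_self bip alt'.
have {}geC := geC ltac:(lia); have {}geC' := geC' ltac:(lia).
move: m_gt0 m'_gt0 m_n1 m'_n1 card2 leC leC' geC geC' selfC selfC'.
set m := #|C :&: _|; set m' := #|~: C :&: _|.
set dC := \sum_(u in C) deg e u; set dC' := \sum_(u in ~: C) deg e u.
set iC := \sum_(u in C) _; set iC' := \sum_(u in ~: C) _.
move=> m_gt0 m'_gt0 m_n1 m'_n1 card2 leC leC' geC geC' selfC selfC'.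
have le_m : 3 * a <= 4 * m + 2 * m' by nia.
have le_m' : 3 * a <= 4 * m' + 2 * m by nia.
have mm' : m = m' by lia.
split; [apply: (complete_of_sum bip alt) | apply: (complete_of_sum bip alt')].
  by rewrite -/m -/iC; nia.
by rewrite -/m' -/iC'; nia.
Qed.

End PairSums.

(** * Exclusion of two complete halves *)

Lemma tperm_invariant (T : finType) (U : Type) (f : T -> U) x y z :
  f x = f y -> f (tperm x y z) = f z.
Proof. by move=> fxy; case: tpermP => [->|->|]. Qed.

Section HamiltonCycle.

Variables (V : finType) (e : rel V) (c : V -> bool) (a : nat).
Implicit Types (u v w : V) (A B C K S : {set V}) (s t : {perm V}) (b : bool).

Notation side := (side c).
Hypothesis bip : forall u v, e u v -> c v = ~~ c u.
Hypothesis card_side : forall b, #|side b| = a.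
Hypothesis strong : strongly_connected e.
Hypothesis a_ge3 : 3 <= a.

(* When both halves are complete, the minimal factor can be conjugated so as to
   use any prescribed arc in each half. *)
Lemma no_crossing_pair s C u u' v v' : min_factor e s ->
  (forall w, w \in C -> s w \in C) -> complete e c C -> complete e c (~: C) ->
  u \in C -> u' \in C -> v \notin C -> v' \notin C ->
  c u = c v -> c u' = ~~ c u -> c v' = ~~ c v -> ~~ (e u v' && e v u').
Proof.
move=> ms sC compC compC' Cu Cu' Cv Cv' cuv cu' cv'; have [fs smin] := ms.
have sCE := closed_perm_mem sC.
have csE w : c (s w) = ~~ c w := factor_side bip w fs.
(* [t] fixes [u] and [v], and preserves [C] and the sides. The conjugate sends [u] to [u'] and [v]
   to [v'], keeps them on different cycles, and is a factor as both halves are complete. *)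
pose t := (tperm u' (s u) * tperm v' (s v))%g.
have memI x y z : (x \in C) = (y \in C) -> (tperm x y z \in C) = (z \in C).
  exact: (tperm_invariant (f := fun z => z \in C)).
have tC w : (t w \in C) = (w \in C).
  by rewrite permM !memI // sCE ?Cu' ?Cu // (negbTE Cv) (negbTE Cv').
have tc w : c (t w) = c w by rewrite permM !(tperm_invariant (f := c)) // csE.
have neqC x z : x \in C -> z \notin C -> z != x.
  by move=> Cx; apply: contraNneq => ->.
have Csu : s u \in C by rewrite sCE.
have Csv : s v \notin C by rewrite sCE.
have tsu : t (s u) = u' by rewrite permM tpermR tpermD ?neqC.
have tsv : t (s v) = v' by rewrite permM (tpermD (z := s v)) ?tpermR 1?eq_sym ?neqC.
have side_neq x y : c x = ~~ c y -> x != y.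
  by move=> cxy; apply: contra_eqN cxy => /eqP->; case: (c y).
have tu : t u = u.
  rewrite permM (tpermD (z := u)) ?side_neq ?cu' ?csE //.
  by rewrite tpermD // side_neq // ?csE ?cv' cuv.
have tv : t v = v.
  rewrite permM (tpermD (z := v)) ?side_neq ?cu' ?csE ?cuv //.
  by rewrite tpermD // side_neq // ?csE ?cv'.
have cjE w : (s ^ t)%g (t w) = t (s w) by rewrite permJ.
have fs' : factor e (s ^ t)%g.
  apply/forallP=> w; rewrite -(permKV t w) cjE; set z := t^-1%g w.
  have [Cz|Cz] := boolP (z \in C).
    by apply: compC; rewrite ?tC ?sCE // !tc csE.
  by apply: compC'; rewrite ?inE ?tC ?sCE // !tc csE.
have ms' : min_factor e (s ^ t)%g.
  by split=> // r /smin; apply: leq_trans; apply: card_porbits_conj.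
have uv : u \notin porbit (s ^ t)%g v.
  rewrite porbit_sym; apply: contra Cv; apply: (subsetP (porbit_closed_sub _ Cu)) => w.
  by rewrite -(permKV t w) cjE !tC sCE.
have := min_factor_unmergeable ms' uv.
by rewrite -{1}tv -{2}tu !cjE tsu tsv.
Qed.

Hypothesis deg_ge : forall v, a <= deg e v.
Hypothesis pairs : forall u v, u != v -> c u = c v -> 3 * a <= deg e u + deg e v.

(** Otherwise both halves are complete, and by [no_crossing_pair] all arcs leaving [C] start on one
    side [b], while all arcs entering [C] start on the other. So vertices of [C] off side [b], and
    outside vertices on side [b], have all their arcs within their own half. Their degrees force
    each half to have at least three quarters of all vertices. *)
Lemma pairs_hamiltonian s : min_factor e s -> forall x y, x \in porbit s y.
Proof.
move=> ms x y; apply/negPn/negP => xy; have [fs _] := ms.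
pose C := porbit s y.
have sC w : w \in C -> s w \in C by rewrite mem_porbit1.
have alt : alternating c s C := factor_alternating bip fs sC.
have alt' := alternating_setC bip fs alt.
have noM u v : u \in C -> v \notin C -> c u = c v -> ~~ (e u (s v) && e v (s u)).
  move=> Cu Cv _; apply: min_factor_unmergeable => //.
  by apply: contra Cv; rewrite /C -!eq_porbit_mem => /eqP<-; rewrite eq_porbit_mem.
have m_gt0 : 0 < #|C :&: side true|.
  have : 0 < #|C| by apply/card_gt0P; exists y; apply: porbit_id.
  by rewrite (alternating_card alt); clear; lia.
have m'_gt0 : 0 < #|~: C :&: side true|.
  have : 0 < #|~: C| by apply/card_gt0P; exists x; rewrite inE.
  by rewrite (alternating_card alt'); clear; lia.
have [compC compC'] := complete_halves bip card_side a_ge3 deg_ge pairs fs alt alt' noM m_gt0 m'_gt0.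
have noX u u' v v' : u \in C -> u' \in C -> v \notin C -> v' \notin C ->
    e u v' -> e v u' -> c v = ~~ c u.
  move=> Cu Cu' Cv Cv' uv' vu'; apply/eqP; apply: contraT => cvu.
  have cuv : c u = c v by case: (c u) (c v) cvu => [] [].
  have := no_crossing_pair ms sC compC compC' Cu Cu' Cv Cv' cuv.
  by rewrite uv' vu' (bip uv') (bip vu') cuv => /(_ erefl erefl).
have [u [v' [Cu Cv' uv']]] := crossing_arc strong (porbit_id s y : y \in C) xy.
have [v [u' [Cv Cu' vu']]] : exists v u', [/\ v \in ~: C, u' \notin ~: C & e v u'].
  by apply: (crossing_arc strong (x := x) (y := y)); rewrite !inE ?negbK ?porbit_id.
rewrite !inE ?negbK in Cv Cu'.
pose b := c u.
have outC w z : w \in C -> z \notin C -> e w z -> c w = b.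
  move=> Cw Cz wz; apply: negb_inj.
  by rewrite -(noX _ _ _ _ Cw Cu' Cv Cz wz vu') -(noX _ _ _ _ Cu Cu' Cv Cv' uv' vu').
have inC w z : w \notin C -> z \in C -> e w z -> c w = ~~ b.
  by move=> Cw Cz wz; rewrite (noX _ _ _ _ Cu Cz Cw Cv' uv' wz).
have degC w : w \in C -> c w = ~~ b -> deg e w <= 2 * #|C :&: side true|.
  move=> Cw cw; rewrite (deg_toC e C) [X in _ + X]big1 ?addn0.
    by rewrite -(alternating_balanced (~~ c w) alt); apply: deg_to_le.
  move=> z; rewrite inE => Cz.
  case: (boolP (e w z)) => [/(outC _ _ Cw Cz)|_]; first by rewrite cw; case: (b).
  case: (boolP (e z w)) => // zw; have := inC _ _ Cz Cw zw.
  by rewrite -cw (bip zw); case: (c z).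
have degC' w : w \notin C -> c w = b -> deg e w <= 2 * #|~: C :&: side true|.
  move=> Cw cw; rewrite (deg_toC e C) [X in X + _]big1 ?add0n.
    by rewrite -(alternating_balanced (~~ c w) alt'); apply: deg_to_le.
  move=> z Cz.
  case: (boolP (e w z)) => [/(inC _ _ Cw Cz)|_]; first by rewrite cw; case: (b).
  case: (boolP (e z w)) => // zw; have := outC _ _ Cz Cw zw.
  by rewrite -cw (bip zw); case: (c z).
have big_half D b' : alternating c s D ->
    (forall w, w \in D -> c w = b' -> deg e w <= 2 * #|D :&: side true|) ->
    0 < #|D :&: side true| -> 3 * a <= 4 * #|D :&: side true|.
  move=> altD degD; have [m1 _|m_n1 m0] := eqVneq #|D :&: side true| 1.
    have : 0 < #|D :&: side b'| by rewrite (alternating_balanced _ altD) m1.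
    case/card_gt0P=> w; rewrite !inE => /andP[Dw /eqP cw].
    by move: (leq_trans (deg_ge w) (degD w Dw cw)) a_ge3; rewrite m1; clear; lia.
  have : 1 < #|D :&: side b'|.
    by rewrite (alternating_balanced _ altD); move: m_n1 m0; clear; lia.
  case/card_gt1P=> w [z []]; rewrite !inE => /andP[Dw /eqP cw] /andP[Dz /eqP cz] wz.
  move: (degD w Dw cw) (degD z Dz cz) (pairs wz (etrans cw (esym cz))).
  by clear; lia.
have degC'' w : w \in ~: C -> c w = b -> deg e w <= 2 * #|~: C :&: side true|.
  by rewrite inE; apply: degC'.
move: (big_half _ _ alt degC m_gt0) (big_half _ _ alt' degC'' m'_gt0).
by move: (card_half_setC card_side C) a_ge3; clear; lia.
Qed.

End HamiltonCycle.

(** * Hamiltonicity: the two cases combined *)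

Section Hamiltonian.

Variables (V : finType) (e : rel V) (c : V -> bool) (a : nat).

Hypothesis bip : forall u v, e u v -> c v = ~~ c u.
Hypothesis card_side : forall b, #|side c b| = a.
Hypothesis strong : strongly_connected e.
Hypothesis a_ge3 : 3 <= a.
Hypothesis meyniel : forall u v, u != v ->
  common_in_neighbour e u v \/ common_out_neighbour e u v ->
  3 * a <= deg e u + deg e v.
Hypothesis has_partner : forall v, exists u, partner e v u.

Lemma hamiltonian : exists2 s, factor e s & forall x y, x \in porbit s y.
Proof.
have [s ms] := ex_min_factor bip card_side strong a_ge3 meyniel.
exists s; first by case: ms.
have [/existsP[u /existsP[v /and3P[uv /eqP cuv npart]]]|] := boolP
    [exists u, exists v, [&& u != v, c u == c v & ~~ partner e u v]].
  exact: nonpartner_hamiltonian ms uv cuv npart.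
rewrite negb_exists => /forallP nonp.
apply: (pairs_hamiltonian bip card_side strong a_ge3) => // [v|u v uv cuv].
  exact: (deg_ge bip card_side a_ge3 meyniel has_partner v).
have := nonp u; rewrite negb_exists => /forallP/(_ v).
by rewrite uv cuv eqxx negbK => /(meyniel_partner meyniel).
Qed.

End Hamiltonian.

(** * Shorter cycles *)

Section ShortCycles.

Variables (V : finType) (e : rel V) (c : V -> bool) (a : nat).
Implicit Types (u v w p q : V) (A B C F K S : {set V}) (s t : {perm V}) (b : bool).

Notation side := (side c).
Hypothesis bip : forall u v, e u v -> c v = ~~ c u.
Hypothesis card_side : forall b, #|side b| = a.

Section HamiltonFactor.

Variable s : {perm V}.
Hypothesis fs : factor e s.
Hypothesis one_orbit : forall x y, x \in porbit s y.

Lemma porbit_setT x : porbit s x = setT.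
Proof. by apply/setP=> y; rewrite inE one_orbit. Qed.

Lemma card_full_porbit x : #|porbit s x| = 2 * a.
Proof. by rewrite porbit_setT cardsT (card_V card_side). Qed.

Lemma iter_side i v : c (iter i s v) = odd i (+) c v.
Proof. by elim: i => //= i IHi; rewrite (factor_side bip) // IHi addNb. Qed.

Lemma iter_inj_orbit v i j : i < 2 * a -> j < 2 * a ->
  iter i s v = iter j s v -> i = j.
Proof. by move=> lti ltj; apply: iter_inj_porbit; rewrite card_full_porbit. Qed.

Lemma hamilton_dicycle : 0 < a -> exists2 C, dicycle e C & size C = 2 * a.
Proof.
move=> a_gt0; have /card_gt0P[x _] : 0 < #|V| by rewrite (card_V card_side); lia.
exists (traject s x #|porbit s x|); last by rewrite size_traject card_full_porbit.
by apply: dicycle_porbit => [v _|]; [apply: (forallP fs) | rewrite card_full_porbit; lia].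
Qed.

Lemma close_segment v i k : 0 < i -> i + k < 2 * a ->
  e v (iter i s v) -> e (iter (k + i) s v) v ->
  exists2 C, dicycle e C & size C = k.+2.
Proof.
move=> i_gt0 ltik vi iv; exists (v :: traject s (iter i s v) k.+1).
  apply: dicycle_cons_traject => //; last by rewrite -iterD.
  - by move=> j _; apply: (forallP fs).
  - by rewrite card_full_porbit; lia.
  apply/negP => /trajectP[j ltj]; rewrite -iterD => vE.
  by have := @iter_inj_orbit v 0 (j + i) _ _ vE; lia.
by rewrite /= size_traject.
Qed.

(** For length [l.+2], try to close up from [s v] through [l] steps of [s]. If the closing arc is
    absent, [v] lacks an in-neighbour and so dominates the opposite side; then start from the third
    successor of [v] instead. If this fails as well, two in-neighbours are lacking and the degree of
    [v] is too small. *)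
Lemma high_degree_bipancyclic v : 1 < a -> 2 * a - 1 <= deg e v -> bipancyclic e.
Proof.
move=> a_gt1 dv k /andP[k_ge2]; rewrite (card_V card_side) leq_eqVlt.
case/orP=> [/eqP-> _|ltk evk]; first by apply: hamilton_dicycle; lia.
have [l kE] : exists l, k = l.+2 by exists k.-2; lia.
have odd_l : odd l = false by move: evk; rewrite kE /= negbK => /negbTE.
rewrite kE; have [v1|nv1] := boolP (e (iter (l + 1) s v) v).
  by apply: (@close_segment v 1) => //; [lia | apply: (forallP fs)].
have in_lt B : (forall u, u \in B -> c u = ~~ c v /\ ~~ e u v) -> indeg e v <= a - #|B|.
  move=> Bv; rewrite -(card_side (~~ c v)) -(setIidPr (_ : B \subset side (~~ c v))); last first.
    by apply/subsetP=> u /Bv[cu _]; rewrite inE cu.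
  rewrite -cardsD; apply: indeg_le => u uv; rewrite inE (in_side bip uv) andbT.
  by apply/negP => /Bv[_]; rewrite uv.
have c1 : c (iter (l + 1) s v) = ~~ c v by rewrite iter_side oddD odd_l.
have c3 : c (iter (l + 3) s v) = ~~ c v by rewrite iter_side oddD odd_l.
have out_v : a <= outdeg e v.
  have /in_lt : forall u, u \in [set iter (l + 1) s v] -> c u = ~~ c v /\ ~~ e u v.
    by move=> u /set1P->.
  by rewrite cards1; move: dv; rewrite /deg; lia.
have v3 : e v (iter 3 s v) by apply: (full_out bip card_side out_v); rewrite iter_side.
have [v3'|nv3] := boolP (e (iter (l + 3) s v) v).
  by apply: (close_segment _ _ v3 v3') => //; move: ltk evk; rewrite kE; lia.
have /in_lt : forall u, u \in [set iter (l + 1) s v; iter (l + 3) s v] ->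
    c u = ~~ c v /\ ~~ e u v.
  by move=> u; rewrite !inE => /orP[] /eqP->.
rewrite cards2; case: eqP => [/iter_inj_orbit|_]; first by move: ltk evk; rewrite kE; lia.
by have := outdeg_le_side bip card_side v; move: dv; rewrite /deg; lia.
Qed.

End HamiltonFactor.

(* A cycle through all vertices except p and q, presented as a permutation with
   the additional 2-cycle (p q), whose arcs need not belong to e. *)
Definition misses_two t p q : Prop :=
  [/\ c q = ~~ c p, t p = q, t q = p,
      forall v, v \notin [set p; q] -> e v (t v) & #|porbits t| <= 2].

(** If no stretch of [l] steps of [t] closes up through [p], each [y] off [p] and [q] admits at most
    one of the arcs from [p] to [y] and from [iter l t y] to [p]. So [p] has at most [a - 1] arcs
    there, plus 2 with [q], fewer than [a.+2]. *)
Lemma misses_two_cycles t p q k : misses_two t p q -> a.+2 <= deg e p ->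
  2 <= k < 2 * a -> ~~ odd k -> exists2 C, dicycle e C & size C = k.
Proof.
case=> cq tp tq et le2 dp /andP[k_ge2 ltk] evk.
have [l kE] : exists l, k = l.+2 by exists k.-2; lia.
have odd_l : odd l = false by move: evk; rewrite kE /= negbK => /negbTE.
set F := [set p; q] in et; have Fp : p \in F by rewrite !inE eqxx.
have tF v : v \in F -> t v \in F.
  by rewrite !inE => /orP[] /eqP->; rewrite ?tp ?tq eqxx ?orbT.
have tFE := closed_perm_mem tF.
have iterF i v : (iter i t v \in F) = (v \in F) by elim: i => //= i <-; rewrite tFE.
have cF b : #|F :&: side b| = 1.
  have pq : p != q by apply: contra_eqN cq => /eqP->; case: (c q).
  rewrite card_setI_side big_setU1 ?inE // big_set1 cq.
  by case: (c p) b => [] [].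
have orbW y : y \notin F -> porbit t y = ~: F by apply: porbit_setC tF le2 Fp.
have cardW : #|~: F| = 2 * a - 2.
  have := cardsC F; rewrite (card_A_side c F true) !cF (card_V card_side); lia.
have citer i y : y \notin F -> c (iter i t y) = odd i (+) c y.
  move=> Fy; elim: i => //= i IHi; have Fi : iter i t y \notin F by rewrite iterF.
  by rewrite (bip (et _ Fi)) IHi addNb.
have [/existsP[y /and3P[Fy py yp]]|noy] :=
    boolP [exists y, [&& y \notin F, e p y & e (iter l t y) p]].
  exists (p :: traject t y l.+1); last by rewrite /= size_traject kE.
  apply: dicycle_cons_traject => //.
  - by move=> i _; apply: et; rewrite iterF.
  - by rewrite orbW // cardW; lia.
  by apply/negP => /trajectP[i _ pE]; move: Fp; rewrite pE iterF (negbTE Fy).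
have : deg_to e (~: F) p <= #|~: F :&: side (~~ c p)|.
  rewrite card_setI_side /deg_to big_split /=.
  have -> : \sum_(v in ~: F) e v p = \sum_(v in ~: F) e (iter l t v) p.
    rewrite (reindex_inj (@perm_inj _ (t ^+ l)%g)) /=.
    by apply: eq_big => [v|v _]; rewrite permX // !in_setC iterF.
  rewrite -big_split /=; apply: leq_sum => y; rewrite inE => Fy.
  move: noy; rewrite negb_exists => /forallP/(_ y); rewrite Fy /=.
  case: (boolP (e p y)) => [/bip-> /= /negbTE->|_ _]; first by rewrite eqxx.
  by case: (boolP (e _ p)) => [/bip->|//]; rewrite citer // odd_l negbK eqxx.
have := deg_to_le bip F p; rewrite cF.
have : #|~: F :&: side (~~ c p)| = a - 1.
  have := cardsID F (side (~~ c p)); rewrite card_side setIC cF.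
  by rewrite setDE setIC; lia.
have := deg_toC e F p; lia.
Qed.

End ShortCycles.

(** * Existence of a cycle through all but two vertices *)

Section MissingTwo.

Variables (V : finType) (e : rel V) (c : V -> bool) (a : nat).
Implicit Types (u v w p q : V) (A B C F K S : {set V}) (t : {perm V}) (b : bool).

Notation side := (side c).
Hypothesis bip : forall u v, e u v -> c v = ~~ c u.
Hypothesis card_side : forall b, #|side b| = a.
Hypothesis a_ge3 : 3 <= a.
Hypothesis deg_ge2 : forall v, a.+2 <= deg e v.
Hypothesis pairs : forall u v, u != v -> c u = c v -> 3 * a <= deg e u + deg e v.

(** [S] and [S'] stand for two unmergeable cycles, [F] for the two missed vertices. The degree sum
    over [S] is compared with its upper bound; the vertex [u0] makes the bound strict. This refutes
    half-size 1 via [deg_ge2], and gives the claim for larger [S] via [pairs]. *)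
Lemma half_bound t S S' F u0 :
  alternating c t S -> alternating c t S' ->
  (forall u v, u \in S -> v \in S' -> c u = c v -> ~~ (e u (t v) && e v (t u))) ->
  (forall u, deg e u = deg_to e S u + deg_to e S' u + deg_to e F u) ->
  (forall u, deg_to e F u <= 2) -> u0 \in S -> deg_to e F u0 <= 1 ->
  #|S :&: side true| + #|S' :&: side true| = a.-1 ->
  a <= (2 * #|S :&: side true|).+1.
Proof.
move=> alt alt' noM degE F2 Su0 Fu0 sumS.
have sumF : \sum_(u in S) deg_to e F u < 2 * #|S|.
  rewrite (bigD1 u0) //= (cardsD1 u0) Su0.
  have : \sum_(u in S | u != u0) deg_to e F u <= #|S :\ u0| * 2.
    rewrite -sum_nat_const [leqRHS](eq_bigl (fun u => (u \in S) && (u != u0))).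
      exact: leq_sum.
    by move=> u; rewrite !inE andbC.
  by move: Fu0; clear; lia.
have lower : a.+2 * #|S| <= \sum_(u in S) deg e u.
  by rewrite mulnC -sum_nat_const; apply: leq_sum => u _; apply: deg_ge2.
have sumE : \sum_(u in S) deg e u =
    \sum_(u in S) deg_to e S u + \sum_(u in S) deg_to e S' u + \sum_(u in S) deg_to e F u.
  by rewrite -!big_split; apply: eq_bigr => u _; apply: degE.
have := sum_deg_to_self bip alt; have := sum_deg_to_cross bip alt alt' noM.
have := sum_deg_ge a_ge3 pairs alt; move: lower sumF sumS.
rewrite sumE (alternating_card alt).
move: (\sum_(u in S) deg_to e S u) (\sum_(u in S) deg_to e S' u) (\sum_(u in S) deg_to e F u).
move: #|S :&: _| #|S' :&: _| a_ge3 => m m'.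
clear; case: m => [|[|m]].
- lia.
- by move=> *; nia.
move=> a_ge3 x y z lower zm mm' /(_ isT) ge3 cross self.
have {}mm' : m' + m + 3 = a by lia.
have ym : y <= 2 * (m.+2 * m') by [].
rewrite leqNgt; apply/negP => lt_a; subst a.
nia.
Qed.

Variable s : {perm V}.
Hypothesis fs : factor e s.
Hypothesis one_orbit : forall x y, x \in porbit s y.
Hypothesis no_misses : forall t p q, ~ misses_two e c t p q.

Let es v : e v (s v) := forallP fs v.
Let cs v : c (s v) = ~~ c v := factor_side bip v fs.
Let iter_s2a v : iter (2 * a) s v = v.
Proof. by rewrite -(card_full_porbit card_side one_orbit v) iter_porbit. Qed.

Lemma side_neq u v : c u = ~~ c v -> u != v.
Proof. by move=> cuv; apply: contra_eqN cuv => /eqP->; case: (c v). Qed.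

Lemma iter_neq v i : 0 < i < 2 * a -> iter i s v != v.
Proof.
move=> lti; apply/eqP => /(@iter_inj_orbit _ _ _ card_side _ one_orbit v i 0).
lia.
Qed.

Lemma card_porbits_s : #|porbits s| <= 1.
Proof.
have /card_gt0P[x _] : 0 < #|V| by rewrite (card_V card_side); lia.
rewrite -(cards1 (porbit s x)); apply/subset_leq_card/subsetP.
by move=> _ /imsetP[y _ ->]; rewrite inE eq_porbit_mem one_orbit.
Qed.

Definition skip x := (tperm x (s (s x)) * s)%g.

Lemma skipE x : [/\ skip x x = s (s (s x)), skip x (s x) = s (s x),
  skip x (s (s x)) = s x &
  forall v, v != x -> v != s (s x) -> skip x v = s v].
Proof.
rewrite /skip; split=> [|||v vx vq]; rewrite permM ?tpermL ?tpermR //.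
  by rewrite tpermD // side_neq // !cs // negbK.
by rewrite tpermD // eq_sym.
Qed.

Lemma card_porbits_skip x : #|porbits (skip x)| <= 2.
Proof. by apply: leq_trans (card_porbits_tperm _ _ _) _; rewrite ltnS card_porbits_s. Qed.

(** With this arc, [skip x] would be a cycle through all vertices but [s x] and [s (s x)]. *)
Lemma no_chord x : ~~ e x (s (s (s x))).
Proof.
apply/negP => xr; have [sx sp sq sv] := skipE x.
apply: (@no_misses (skip x) (s x) (s (s x))); split; [exact: cs | exact: sp | exact: sq | |].
- move=> v; rewrite !inE negb_or => /andP[vp vq].
  by have [->|vx] := eqVneq v x; [rewrite sx | rewrite sv].
- exact: card_porbits_skip.
Qed.

(* A vertex w with arcs x -> s w and w -> s^3 x splits the cycle without s x and
   s^2 x into two cycles; since they cannot be merged, they have equal length. *)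
Lemma split_position x w : e x (s w) -> e w (s (s (s x))) ->
  w = iter (a - 2) s (s (s (s x))).
Proof.
move=> xw wr; have [sx sp sq sv] := skipE x.
set p := s x in sp sq sv sx *; set q := s p in sp sq sv sx wr *.
set r := s q in sx wr *.
have cw : c w = c x by apply: negb_inj; rewrite -(bip xw) cs.
have cp : c p = ~~ c x by rewrite cs.
have cq : c q = c x by rewrite cs cp negbK.
have cr : c r = ~~ c x by rewrite cs cq.
have noxr : ~~ e x r := no_chord x.
have wx : w != x by apply: contraNneq noxr => <-.
have wq : w != q by apply: contraNneq noxr => wq; move: xw; rewrite wq.
have wp : w != p by rewrite side_neq // cp negbK.
have qx : q != x by apply: (@iter_neq x 2); move: a_ge3; clear; lia.
have pq : p != q by rewrite side_neq // cp cq.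
have px : p != x by rewrite side_neq.
have [k ltk wE] : exists2 k, k < 2 * a & w = iter k s r.
  have := one_orbit w r => /porbit_iterP.
  by rewrite (card_full_porbit card_side one_orbit).
have idx i j : i < 2 * a -> j < 2 * a -> iter i s r = iter j s r -> i = j.
  by apply: (@iter_inj_orbit _ _ _ card_side _ one_orbit r).
have idx_neq i j : i < 2 * a -> j < 2 * a -> i != j -> iter i s r != iter j s r.
  by move=> lti ltj; apply: contra => /eqP/(idx _ _ lti ltj)->.
(* Counted from [r], the last three vertices of the cycle are [x], [p], [q]. So [w] comes before
   them, and by parity not immediately before [x]. *)
have xE : x = iter (2 * a - 3) s r.
  have a3 : 2 * a = (2 * a - 3) + 3 by move: a_ge3; clear; lia.
  by rewrite -{1}(iter_s2a x) a3 iterD addnK.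
have pE : p = iter (2 * a - 2) s r.
  have -> : 2 * a - 2 = (2 * a - 3).+1 by move: a_ge3; clear; lia.
  by rewrite iterS -xE.
have qE : q = iter (2 * a - 1) s r.
  have -> : 2 * a - 1 = (2 * a - 2).+1 by move: a_ge3; clear; lia.
  by rewrite iterS -pE.
have k3 : k != 2 * a - 3 by apply: contra wx => /eqP kE; rewrite wE kE -xE.
have k2 : k != 2 * a - 2 by apply: contra wp => /eqP kE; rewrite wE kE -pE.
have k1 : k != 2 * a - 1 by apply: contra wq => /eqP kE; rewrite wE kE -qE.
have oddk : odd k.
  have := iter_side bip fs k r; rewrite -wE cw cr.
  by case: (odd k) (c x) => [] [].
have k4 : k < 2 * a - 4 by move: oddk k1 k2 k3 ltk a_ge3; clear; lia.
(* [t] closes the path from [r] to [x] up as two cycles, one from [r] to [w] and one from [s w] to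
   [x], and swaps [p] and [q]. *)
pose t := (tperm x w * skip x)%g.
have tx : t x = s w by rewrite permM tpermL sv.
have tw : t w = r by rewrite permM tpermR sx.
have tp : t p = q by rewrite permM tpermD ?sp // eq_sym.
have tq : t q = p by rewrite permM tpermD ?sq // eq_sym.
have tv v : v != x -> v != q -> v != w -> t v = s v.
  by move=> vx vq vw; rewrite permM tpermD ?sv // eq_sym.
set F := [set p; q].
have et v : v \notin F -> e v (t v).
  rewrite !inE negb_or => /andP[vp vq].
  have [->|vx] := eqVneq v x; first by rewrite tx.
  have [->|vw] := eqVneq v w; first by rewrite tw.
  by rewrite tv.
have tF v : v \in F -> t v \in F.
  by rewrite !inE => /orP[] /eqP->; rewrite ?tp ?tq eqxx ?orbT.
pose C := [set v in traject s r k.+1].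
have inC i : i < 2 * a -> (iter i s r \in C) = (i <= k).
  move=> lti; rewrite inE; apply/trajectP/idP => [[j ltj /idx]|leik]; last by exists i.
  by move: ltj ltk lti; clear => ltj ltk lti /(_ lti) -> //; lia.
have CP v : v \in C -> exists2 i, i <= k & v = iter i s r.
  by rewrite inE => /trajectP[i lti ->]; exists i.
have lt2a i : i <= k -> i < 2 * a by move: ltk; clear; lia.
have neqC j i : i <= k -> k < j < 2 * a -> iter i s r != iter j s r.
  move=> lei /andP[ltj ltj2]; apply/eqP => /(idx _ _ (lt2a _ lei) ltj2) ij.
  by move: lei ltj; rewrite ij; clear; lia.
have tC v : v \in C -> t v \in C.
  case/CP=> i lei ->; have [iw|iw] := eqVneq i k.
    by rewrite iw -wE tw -[r]/(iter 0 s r) inC //; move: ltk; clear; lia.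
  rewrite tv; first by rewrite -iterS inC; move: iw lei ltk; clear; lia.
  - by rewrite xE neqC //; move: k4; clear; lia.
  - by rewrite qE neqC //; move: k4; clear; lia.
  by rewrite wE; apply: contra iw => /eqP/(idx _ _ (lt2a _ lei) ltk)->.
have FC v : v \in F -> v \notin C.
  rewrite !in_set2 => /orP[] /eqP->; [rewrite pE | rewrite qE];
  by rewrite inC -?ltnNge; move: k4; clear; lia.
pose K := ~: F :\: C.
have tK v : v \in K -> t v \in K.
  rewrite !in_setD !in_setC (closed_perm_mem tC) (closed_perm_mem tF) //.
have altC : alternating c t C.
  move=> v Cv; split; first exact: tC.
  by apply/bip/et; apply/negP => /FC; rewrite Cv.
have altK : alternating c t K.
  move=> v Kv; split; first exact: tK.
  by apply/bip/et; move: Kv; rewrite in_setD in_setC => /andP[].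
(* [t] has at most three cycles, so a merge of [C] with [K] would leave at most two and contradict
   [no_misses]. *)
have noM u v : u \in C -> v \in K -> c u = c v -> ~~ (e u (t v) && e v (t u)).
  move=> Cu Kv cuv; apply/negP => /andP[utv vtu].
  have uF : u \notin F by apply/negP => /FC; rewrite Cu.
  have [vF vC] : v \notin F /\ v \notin C by move: Kv; rewrite in_setD in_setC => /andP[].
  have uv_out z : z \in F -> (u != z) && (v != z).
    by move=> Fz; rewrite (contraNneq _ uF) ?(contraNneq _ vF) // => ->.
  apply: (@no_misses (tperm u v * t)%g p q); split.
  - by rewrite cq cp negbK.
  - by rewrite permM tpermD //; have /andP[] := uv_out p (set21 _ _).
  - by rewrite permM tpermD //; have /andP[] := uv_out q (set22 _ _).
  - by move=> z zF; rewrite permM; case: tpermP => [->|->|_ _] //; apply: et.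
  rewrite -ltnS; apply: leq_trans (card_porbits_merge _) _.
    rewrite porbit_sym; apply: contra vC.
    exact: (subsetP (porbit_closed_sub tC Cu)).
  apply: leq_trans (card_porbits_tperm _ _ _) _.
  by rewrite ltnS card_porbits_skip.
have degE u : deg e u = deg_to e C u + deg_to e K u + deg_to e F u.
  rewrite (deg_toC e F) addnC; congr (_ + _); rewrite {1}/deg_to (bigID (mem C)) /=.
  congr (_ + _); apply: eq_bigl => v; rewrite ?in_setD !in_setC.
    by case: (boolP (v \in C)) => [Cv|]; rewrite ?andbF // (contraTN (@FC v)).
  by rewrite andbC.
have cF b : #|F :&: side b| = 1.
  rewrite card_setI_side big_setU1 ?inE // big_set1 cq cp.
  by case: (c x) b => [] [].
have F2 u : deg_to e F u <= 2.
  by apply: leq_trans (deg_to_le bip F u) _; rewrite cF.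
have cards : #|C :&: side true| + #|K :&: side true| = a.-1.
  have := cardsID F (side true); rewrite card_side setIC cF => sideD.
  have := cardsID C (side true :\: F).
  have -> : (side true :\: F) :&: C = C :&: side true.
    apply/setP=> v; rewrite !in_setI in_setD.
    by case: (boolP (v \in C)) => [Cv|]; rewrite ?andbF // (contraTN (@FC v)) ?andbT.
  have -> : (side true :\: F) :\: C = K :&: side true.
    by apply/setP=> v; rewrite in_setI !in_setD in_setC andbA.
  by move: sideD; clear; lia.
have degF u : deg_to e F u = (e u p + e p u) + (e u q + e q u).
  by rewrite /deg_to big_setU1 ?inE // big_set1.
(* [s r] is the third successor of [p], so [no_chord] removes one of its two possible arcs with [F].
   For [K], the predecessor of [x] plays this part, with [q] as its third successor. *)
have boundC : a <= (2 * #|C :&: side true|).+1.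
  apply: (half_bound (u0 := s r) altC altK noM degE F2) => //.
    rewrite -[s r]/(iter 1 s r) inC; first by move: oddk; clear; lia.
    by move: a_ge3; clear; lia.
  rewrite degF (negbTE (no_chord p)).
  have csr : c (s r) = c q by rewrite cs cr cq negbK.
  have -> : e (s r) q = false.
    by apply/negP => /bip; rewrite csr; case: (c q).
  have -> : e q (s r) = false.
    by apply/negP => /bip; rewrite csr; case: (c q).
  by rewrite !addn0; case: (e _ _).
have boundK : a <= (2 * #|K :&: side true|).+1.
  set z := iter (2 * a - 4) s r.
  have szx : s z = x.
    by rewrite xE /z -iterS; congr (iter _ s r); move: a_ge3; clear; lia.
  have cz : c z = c p by rewrite cp -szx cs negbK.
  apply: (half_bound (u0 := z) altK altC) => //.
  - move=> u v Ku Cv cuv; rewrite andbC; exact: noM.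
  - by move=> u; rewrite degE; congr (_ + _); rewrite addnC.
  - rewrite in_setD in_setC /z inC -?ltnNge; last by move: a_ge3; clear; lia.
    rewrite k4 in_set2 pE qE negb_or.
    by apply/and3P; split=> //; apply: idx_neq; move: a_ge3; clear; lia.
  - rewrite degF; have := no_chord z; rewrite szx -/p -/q => /negbTE->.
    have -> : e z p = false by apply/negP => /bip; rewrite cz; case: (c p).
    have -> : e p z = false by apply/negP => /bip; rewrite cz; case: (c p).
    by case: (e _ _).
  - by rewrite addnC.
have cardC : #|C| = k.+1.
  rewrite cardsE (card_uniqP _) ?size_traject //.
  by apply: uniq_traject_perm; rewrite (card_full_porbit card_side one_orbit).
rewrite wE; congr (iter _ s r).
(* Both bounds together with the total [a.-1] force [#|C| = a - 1], that is [k = a - 2]. *)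
have := alternating_card altC; rewrite cardC.
by move: cards boundC boundK a_ge3; clear; lia.
Qed.

(** Each [w] on the side of [x] is charged with the arcs from [x] to [s w] and from [w] to the third
    successor of [x]; by [split_position] both occur for one [w] at most. *)
Lemma outdeg_indeg_le x : outdeg e x + indeg e (s (s (s x))) <= a.+1.
Proof.
set r := s (s (s x)).
rewrite outdeg_sum indeg_sum (reindex_inj (@perm_inj _ s)) /= -big_split /=.
have -> : a.+1 = \sum_v ((c v == c x) + (v == iter (a - 2) s r)).
  rewrite big_split /= -(card_side (c x)) -addn1; congr (_ + _).
    by rewrite -sum1dep_card big_mkcond; apply: eq_bigr => v _; case: eqP.
  move: (iter _ s r) => z.
  by rewrite (bigD1 z) //= eqxx big1 // => v /negbTE->.
apply: leq_sum => w _.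
have [xw|_] := boolP (e x (s w)).
  have -> : c w == c x by apply/eqP/negb_inj; rewrite -(bip xw) cs.
  have [wr|//] := boolP (e w r).
  by have -> : w == iter (a - 2) s r by apply/eqP/split_position.
have [wr|//] := boolP (e w r).
have -> // : c w == c x.
by apply/eqP/negb_inj; rewrite -(bip wr) !cs negbK.
Qed.

(** Summing [outdeg_indeg_le] over all [x] bounds the degree sum by [2 * a * a.+1], which is less
    than [3 * a * a] for [3 <= a]. *)
Lemma no_misses_absurd : False.
Proof.
have : \sum_x (outdeg e x + indeg e (s (s (s x)))) <= 2 * a * a.+1.
  by rewrite -(card_V card_side) -sum_nat_const; apply: leq_sum => x _; apply: outdeg_indeg_le.
rewrite big_split /=.
have <- : \sum_x indeg e x = \sum_x indeg e (s (s (s x))).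
  rewrite (reindex_inj (@perm_inj _ s)) /= (reindex_inj (@perm_inj _ s)) /=.
  by rewrite (reindex_inj (@perm_inj _ s)).
rewrite -big_split /=.
have altT : alternating c s setT by move=> v _; rewrite inE cs.
have := sum_deg_ge a_ge3 pairs altT; rewrite setTI card_side.
have -> : \sum_(u in setT) deg e u = \sum_u (outdeg e u + indeg e u).
  by apply: eq_bigl => u; rewrite inE.
move: a_ge3; move: (\sum_u _); clear.
by move=> n a_ge3 /(_ ltac:(lia)); nia.
Qed.

End MissingTwo.

(** * Conclusion *)

Section Bipancyclic.

Variables (V : finType) (e : rel V) (c : V -> bool) (a : nat).
Implicit Types (u v p q : V) (t : {perm V}).

Hypothesis bip : forall u v, e u v -> c v = ~~ c u.
Hypothesis card_side : forall b, #|side c b| = a.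
Hypothesis strong : strongly_connected e.
Hypothesis a_ge3 : 3 <= a.
Hypothesis meyniel : forall u v, u != v ->
  common_in_neighbour e u v \/ common_out_neighbour e u v ->
  3 * a <= deg e u + deg e v.

Lemma misses_twoP t p q : reflect (misses_two e c t p q)
  [&& c q == ~~ c p, t p == q, t q == p,
      [forall v, (v \notin [set p; q]) ==> e v (t v)] & #|porbits t| <= 2].
Proof.
apply: (iffP and5P) => [[/eqP ? /eqP ? /eqP ? /forallP et ?]|[? ? ? et ?]].
  by split=> // v; apply/implyP.
by split=> //; [apply/eqP | apply/eqP | apply/eqP | apply/forallP=> v; apply/implyP/et].
Qed.

Lemma bipancyclic_or_directed_cycle :
  bipancyclic e \/ is_directed_cycle e (2 * a).
Proof.
have [s0 fs0] := ex_factor bip card_side strong a_ge3 meyniel.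
have [|has_partner] :=
  directed_cycle_or_partner bip card_side strong a_ge3 meyniel fs0; first by right.
left; have [s fs one_orbit] := hamiltonian bip card_side strong a_ge3 meyniel has_partner.
have [/existsP[v dv]|] := boolP [exists v, 2 * a - 1 <= deg e v].
  by apply: (high_degree_bipancyclic bip card_side fs one_orbit _ dv); lia.
rewrite negb_exists => /forallP deg_lt.
have {}deg_lt v : deg e v <= 2 * a - 2 by have := deg_lt v; rewrite -ltnNge; lia.
(* A partner of [v] has degree at most [2 * a - 2]. *)
have deg_ge2 v : a.+2 <= deg e v.
  have [u /(meyniel_partner meyniel)] := has_partner v.
  by have := deg_lt u; move: a_ge3; clear; lia.
(* If [u] and [v] shared no neighbour, a third vertex on their side would have degree [2 * a],
   against [deg_lt]. *)
have pairs u v : u != v -> c u = c v -> 3 * a <= deg e u + deg e v.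
  move=> uv cuv; have [/(meyniel_partner meyniel)//|npart] := boolP (partner e u v).
  have [w cw] : exists2 w, c w = c u & w \notin [set u; v].
    by apply: (ex_side card_side); rewrite cards2 uv.
  rewrite !inE negb_or => /andP[wu wv].
  have := full_others bip card_side strong a_ge3 meyniel has_partner uv cuv npart wu wv cw.
  by have := deg_lt w; move: a_ge3; clear; lia.
have [t [p [q tpq]]] : exists t p q, misses_two e c t p q.
  have [/existsP[t /existsP[p /existsP[q /misses_twoP tpq]]]|none] := boolP
      [exists t : {perm V}, exists p, exists q,
        [&& c q == ~~ c p, t p == q, t q == p,
          [forall v, (v \notin [set p; q]) ==> e v (t v)] & #|porbits t| <= 2]].
    by exists t, p, q.
  case: (no_misses_absurd bip card_side a_ge3 deg_ge2 pairs fs one_orbit) => t p q.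
  move/misses_twoP=> tpq; case/negP: none.
  by apply/existsP; exists t; apply/existsP; exists p; apply/existsP; exists q.
move=> k /andP[k_ge2]; rewrite (card_V card_side) leq_eqVlt => /orP[/eqP-> _|ltk evk].
  by apply: (hamilton_dicycle card_side fs one_orbit); lia.
by apply: (misses_two_cycles bip card_side tpq (deg_ge2 p)); rewrite ?k_ge2.
Qed.

End Bipancyclic.

Theorem theorem1p3 (V : finType) (e : rel V) (a : nat) (X Y : {set V}) :
  irreflexive e ->
  strongly_connected e ->
  bipartition e X Y ->
  #|X| = a ->
  #|Y| = a ->
  3 <= a ->
  (forall u v : V, u != v ->
     common_in_neighbour e u v \/ common_out_neighbour e u v ->
     3 * a <= deg e u + deg e v) ->
  bipancyclic e \/ is_directed_cycle e (2 * a).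
Proof.
move=> _ strong [XY dXY indX indY] cardX cardY a_ge3 meyniel.
have YE : Y = ~: X.
  apply/setP=> v; have := in_setT v; rewrite -XY !inE.
  by case: (boolP (v \in X)) => //= /(disjointFr dXY).
apply: (bipancyclic_or_directed_cycle (c := fun v => v \in X)) => //.
- move=> u v uv; case: (boolP (u \in X)) => [Xu|Xu].
    by apply/negbTE/negP => Xv; have := indX u v Xu Xv; rewrite uv.
  apply: contraT => Xv; have := indY u v; rewrite YE !inE => /(_ Xu Xv).
  by rewrite uv.
case; first by rewrite -cardX; apply: eq_card => v; rewrite !inE eqb_id.
by rewrite -cardY YE; apply: eq_card => v; rewrite !inE eqbF_neg.
Qed.
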